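(* Let $\xi$ be an offspring distribution with $\mathbf{E}\{\xi\}=1$ and variance $\sigma^2=\mathbf{V}\{\xi\}\in(0,\infty)$, and let $T_n$ be a $\xi$-Galton-Watson tree conditioned to have exactly $n$ nodes. Then the Horton-Strahler number $\mathrm{H}(T_n)$ satisfies $$\frac{\mathrm{H}(T_n)}{\log_2 n}\to\frac12$$ in probability as $n\to\infty$.
   Context: An offspring distribution is the law of a random variable $\xi$ with values in $\{0,1,2,\dots\}$; write $p_i=\mathbf{P}\{\xi=i\}$. The (unconditional) $\xi$-Galton-Watson tree $T$ is the random rooted ordered tree in which each node independently has $i$ children with probability $p_i$; when $\mathbf{E}\{\xi\}=1$ and $p_1\neq 1$ it is almost surely finite. $|T|$ is its number of nodes. $T_n$ denotes a random tree with the law of $T$ given $|T|=n$; here $n$ ranges only over integers with $\mathbf{P}\{|T|=n\}>0$. Horton-Strahler number $\mathrm{H}(T)$ of a finite rooted tree $T$: if $T$ is a single node, $\mathrm{H}(T)=0$. Otherwise, let $S$ be the set of children of the root and, for $u\in S$, let $T[u]$ be the subtree rooted at $u$; then $\mathrm{H}(T)=\max_{u\in S}\mathrm{H}(T[u])+\mathbf{1}_{[\text{at least two } u\in S \text{ attain this maximum}]}$. *)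

(* Defs.v *)
From HB Require Import structures.
From mathcomp Require Import all_boot all_order all_algebra.
From mathcomp Require Import all_classical all_reals all_analysis.

Set Implicit Arguments.
Unset Strict Implicit.
Unset Printing Implicit Defensive.

Import Order.TTheory GRing.Theory Num.Theory.
Import numFieldNormedType.Exports.

Local Open Scope classical_set_scope.
Local Open Scope ring_scope.

Inductive tree : Type := Node of seq tree.

Fixpoint tree_encode (t : tree) : GenTree.tree unit :=
  let: Node s := t in GenTree.Node 0 (map tree_encode s).

Fixpoint tree_decode (t : GenTree.tree unit) : tree :=
  match t with
  | GenTree.Leaf _ => Node [::]
  | GenTree.Node _ s => Node (map tree_decode s)
  end.

Lemma tree_encodeK : cancel tree_encode tree_decode.
Proof.
rewrite /cancel; fix IH 1 => -[s] /=; congr Node.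
by elim: s => //= t s ->; rewrite IH.
Qed.

HB.instance Definition _ := Countable.copy tree (can_type tree_encodeK).
HB.instance Definition _ := isPointed.Build tree (Node [::]).
HB.instance Definition _ := @isMeasurable.Build default_measure_display
  tree discrete_measurable discrete_measurable0
  discrete_measurableC discrete_measurableU.

Fixpoint nb_nodes (t : tree) : nat :=
  let: Node s := t in (sumn (map nb_nodes s)).+1.

Fixpoint horton_strahler (t : tree) : nat :=
  let: Node s := t in
  if s is [::] then 0%N else
  let h := map horton_strahler s in
  let m := foldr maxn 0%N h in
  (m + (2 <= count_mem m h))%N.

(* Nodes are addressed by words: the root by [::], and the i-th child (from 0)
   of the root of t is the root of the subtree that the rest of the word
   explores. *)
Fixpoint subtree (t : tree) (u : seq nat) {struct u} : option tree :=
  if u is i :: v then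
    let: Node s := t in if onth s i is Some c then subtree c v else None
  else Some t.

(* t is the finite tree in which each node u has exactly f u children; no t
   qualifies when the tree generated by f is infinite. *)
Definition generates (f : seq nat -> nat) (t : tree) : Prop :=
  forall (u : seq nat) (s : seq tree), subtree t u = Some (Node s) ->
    size s = f u.

Lemma generates_unique (f : seq nat -> nat) (t1 t2 : tree) :
  generates f t1 -> generates f t2 -> t1 = t2.
Proof.
move: t1 f t2; fix IH 1 => -[s1] f [s2] g1 g2; congr Node.
have e1 := g1 [::] s1 erefl; have e2 := g2 [::] s2 erefl.
have {e1 e2} es : size s1 = size s2 by rewrite e1 e2.
pose f' k i u := f ((i + k)%N :: u).
have {g1}h1 i u s : obind (subtree^~ u) (onth s1 i) = Some (Node s) ->
    size s = f' 0%N i u.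
  by move=> E; rewrite /f' addn0; apply: g1 => /=; case: (onth s1 i) E.
have {g2}h2 i u s : obind (subtree^~ u) (onth s2 i) = Some (Node s) ->
    size s = f' 0%N i u.
  by move=> E; rewrite /f' addn0; apply: g2 => /=; case: (onth s2 i) E.
move: (f' 0%N) h1 h2 => {f'} g h1 h2.
elim: s1 s2 es g h1 h2 => [|c1 s1 IHs] [|c2 s2] //= [es] g h1 h2.
congr cons; first by apply: (IH _ (g 0%N)) => u s E; [exact: (h1 0%N)|exact: (h2 0%N)].
by apply: (IHs s2 es (fun i => g i.+1)) => i; [exact: (h1 i.+1)|exact: (h2 i.+1)].
Qed.

Section Probability.
Context {R : realType}.

Definition mutually_independent {I : choiceType} {d d' : measure_display}
    {Om : measurableType d} {S : measurableType d'} (P : probability Om R)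
    (X : I -> {RV P >-> S}) : Prop :=
  forall (s : seq I) (B : I -> set S), uniq s -> (forall i, measurable (B i)) ->
    P (\bigcap_(i in [set` s]) (X i @^-1` B i)) =
      (\prod_(i <- s) P (X i @^-1` B i))%E.

Definition cond_prob {d : measure_display} {Om : measurableType d}
    (P : probability Om R) (A B : set Om) : R :=
  fine (P (A `&` B)) / fine (P B).

Definition log2 (x : R) : R := ln x / ln 2.

(* The variables Y n may live on different probability spaces. *)
Definition cvg_in_probability (F : set_system nat) {d : nat -> measure_display}
    {Om : forall n, measurableType (d n)} (P : forall n, probability (Om n) R)
    (Y : forall n, Om n -> R) (l : R) : Prop :=
  forall eps : R, 0 < eps ->
    P n [set w | eps < `|Y n w - l|] @[n --> F] --> 0%E.

Section GaltonWatson.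
Context {d : measure_display} {Om : measurableType d} {P : probability Om R}.

(* X u is the number of children of node u, if u belongs to the tree. *)
Definition galton_watson {d0 : measure_display} {Om0 : measurableType d0}
    {P0 : probability Om0 R} (xi : {RV P0 >-> nat})
    (X : seq nat -> {RV P >-> nat}) : Prop :=
  mutually_independent X /\
  forall (u : seq nat) (A : set nat),
    distribution P (X u) A = distribution P0 xi A.

(* The event that the tree T generated by X is finite and belongs to A. *)
Definition gw_in (X : seq nat -> {RV P >-> nat}) (A : set tree) : set Om :=
  [set w | exists2 t : tree, generates (fun u => X u w) t & A t].

Definition has_size (n : nat) : set tree := [set t | nb_nodes t = n].

Definition admissible (X : seq nat -> {RV P >-> nat}) : set nat :=
  [set n | (0 < P (gw_in X (has_size n)))%E].

Definition conditioned_gw (X : seq nat -> {RV P >-> nat}) (n : nat)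
    {d' : measure_display} {Om' : measurableType d'} {P' : probability Om' R}
    (T : {RV P' >-> tree}) : Prop :=
  forall A : set tree, distribution P' T A =
    (cond_prob P (gw_in X A) (gw_in X (has_size n)))%:E.

End GaltonWatson.
End Probability.

(* Main.v *)
Require Import Defs.
From HB Require Import structures.
From mathcomp Require Import all_boot all_order all_algebra.
From mathcomp Require Import all_classical all_reals all_analysis.
From mathcomp Require Import zify ring lra.

(** Write q(t) for the product of the offspring probabilities of the degrees of
    a finite tree t; it is the probability that the Galton-Watson tree T is t
    ([P_tree_event]). Everything reduces to finite sums of q over the trees
    with n nodes.

    Tail of the Horton-Strahler number. H(t) > k says that some child of the
    root has H > k or that at least two children have H >= k ([horton_ge]).
    With s_k = P(H(T) >= k) and f the offspring generating function this reads
    s_{k+1} (1 - f'(1-s_k)) = 1 - f(1-s_k) - s_k f'(1-s_k). As s goes to 0 the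
    right-hand side is equivalent to sigma^2 s^2 / 2 and the factor on the left
    to sigma^2 s, so s_k decays like 2^-(k(1+o(1))). Only one-sided versions of
    the recursion are used, with numerical sequences that dominate its solution:
    [horton_tail] bounds s_k from above, and [horton_small] shows that the
    generating function, in the number of nodes, of the trees with H < k is
    still at most 1 at z = 1 + c 4^-k, up to the o(1).

    Lower bound on H(T_n). By [horton_small], P(H(T) < k, |T| = n) is at most
    z^-n for this z, which is smaller than every power of n when k is below
    (1/2 - eps) log2 n, whereas P(|T| = n) is at least of order n^(-3/2).

    Upper bound on H(T_n). Dividing s_k by P(|T| = n) would lose a factor n.
    Instead, if H(t) >= k+2, then somewhere in t sits a subtree with at most half
    of the nodes at whose root two subtrees with H >= k meet ([small_junction]);
    the probability that T has such a root is only O(s_k^2). The cycle lemma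
    ([mem_cycle_lemma], [uniq_cycle_lemma]) identifies a tree with n nodes and
    a distinguished node with an arbitrary word of length n and sum n - 1. So
    the expected number of these subtrees in T_n is n times a sum over them of
    q(u) P(W_{n-|u|} = n-|u|) / P(W_n = n-1), where W is the random walk with
    the offspring law as step law ([fringe_union_bound]). As |u| <= n/2, the
    quotient is bounded, and the expected number is O(n s_k^2), which tends to
    0 when k is above (1/2 + eps) log2 n.

    Local limit estimate. What is needed about W is P(W_m = x) = O(m^(-1/2)) and
    P(W_n = n-1) >= c n^(-1/2) for all large n for which this probability is not
    0 ([walk_upper], [walk_lower]). Both 0 and some B >= 2 have positive
    probability, so that with positive probability a step is a fair choice
    between 0 and B. Conditionally on the other choices W is an affine function
    of a symmetric binomial variable, whose law is explicit, and Chebyshev's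
    inequality controls the conditioning. A bounded number of steps is set aside
    to adjust the residue of W modulo B. *)

Set Implicit Arguments.
Unset Strict Implicit.
Unset Printing Implicit Defensive.

Import Order.TTheory GRing.Theory Num.Theory.
Import numFieldNormedType.Exports.

(** * Depth-first codes and the cycle lemma *)

Lemma tree_memind (Q : tree -> Prop) :
  (forall s, (forall c, c \in s -> Q c) -> Q (Node s)) -> forall t, Q t.
Proof.
move=> IH t; have [n] := ubnP (nb_nodes t); elim: n t => // n IHn [s] /= tn.
apply: IH => c cs; apply: IHn; rewrite ltnS in tn; apply: leq_trans tn.
rewrite ltnS; elim: s cs => //= d s IHs; rewrite inE => /predU1P[->|/IHs h].
  exact: leq_addr.
exact: leq_trans h (leq_addl _ _).
Qed.

Fixpoint seqs (T : Type) (s : seq T) (n : nat) : seq (seq T) :=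
  if n is m.+1 then [seq c :: l | c <- s, l <- seqs s m] else [:: [::]].

Lemma mem_seqs (T : eqType) (s : seq T) n l :
  (l \in seqs s n) = (size l == n) && all [in s] l.
Proof.
elim: n l => [|n IH] [|c l] //=.
  by apply/negbTE/allpairsP => -[[? ?] []].
rewrite eqSS andbCA -IH.
apply/allpairsP/andP => [[[c' l'] /= [cs ls [-> ->]]]|[cs ls]] //.
by exists (c, l).
Qed.

Lemma uniq_seqs (T : eqType) (s : seq T) n : uniq s -> uniq (seqs s n).
Proof.
by move=> us; elim: n => //= n IH; apply: allpairs_uniq => // -[? ?] [? ?] _ _ [-> ->].
Qed.

(** The depth-first (Lukasiewicz) word of degrees. *)
Fixpoint code (t : tree) : seq nat :=
  let: Node s := t in size s :: flatten (map code s).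

Definition forest_code (ts : seq tree) : seq nat := flatten (map code ts).

Lemma forest_code1 t : forest_code [:: t] = code t.
Proof. by rewrite /forest_code /= cats0. Qed.

(** Reading the first letter replaces the first tree of the forest by the
    forest of its children; all inductions on codes follow this step. *)
Lemma forest_code_cons s ts : forest_code (Node s :: ts) = size s :: forest_code (s ++ ts).
Proof. by rewrite /forest_code map_cat flatten_cat. Qed.

Lemma size_code t : size (code t) = nb_nodes t.
Proof.
elim/tree_memind: t => s IH /=; congr S.
by elim: s IH => //= c s IHs IH; rewrite size_cat IH ?mem_head// IHs// => d ds; rewrite IH// inE ds orbT.
Qed.

Lemma sumn_forest_code (ts : seq tree) : sumn (forest_code ts) + size ts = size (forest_code ts).
Proof.
have H t : (sumn (code t)).+1 = size (code t).
  elim/tree_memind: t => s IH /=; congr S; rewrite addnC.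
  elim: s IH => //= c s IHs IH; rewrite sumn_cat size_cat -IHs => [|d ds].
    by rewrite -IH ?mem_head//; lia.
  by rewrite IH// inE ds orbT.
elim: ts => //= c ts IH; rewrite /forest_code /= sumn_cat size_cat -[flatten _]/(forest_code ts).
by rewrite -H; lia.
Qed.

Lemma sumn_code t : (sumn (code t)).+1 = nb_nodes t.
Proof. by have := sumn_forest_code [:: t]; rewrite forest_code1 size_code addn1. Qed.

(** A proper prefix of the code of a forest has not yet closed all its
    trees: after i letters, the difference of the two sides counts the trees
    that remain to be read. *)
Lemma forest_code_prefix ts i : i < size (forest_code ts) ->
  i < sumn (take i (forest_code ts)) + size ts.
Proof.
have [n] := ubnP (size (forest_code ts)); elim: n => // n IH in ts i *.
case: ts => [|[s] ts]; first by rewrite /forest_code.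
rewrite forest_code_cons /= !ltnS => sz; case: i => [|i]; first by rewrite addn_gt0 orbT.
move=> ilt; have := IH (s ++ ts) i sz ilt.
by rewrite size_cat /=; lia.
Qed.

(** Decoding: the letters are read from the right, each letter a grouping the
    first a trees of the forest decoded so far under a new root. *)
Lemma forest_code_surj w m : size w = sumn w + m ->
  (forall i, i < size w -> i < sumn (take i w) + m) ->
  exists2 ts, size ts = m & forest_code ts = w.
Proof.
elim: w m => [|a w IH] m /=; first by move=> m0 _; exists [::] => //=; lia.
move=> sz H; have m0 : 0 < m by have := H 0 isT.
have [|i ilt|ts tsm tsw] := IH (m.-1 + a).
- by move: sz m0; lia.
- by have := H i.+1 ilt; rewrite /=; move: m0; lia.
exists (Node (take a ts) :: drop a ts).
  by rewrite /= size_drop tsm; move: m0; lia.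
by rewrite forest_code_cons cat_take_drop tsw size_take tsm; congr cons; case: ifP; lia.
Qed.

Lemma forest_code_inj ts1 ts2 w1 w2 : size ts1 = size ts2 ->
  forest_code ts1 ++ w1 = forest_code ts2 ++ w2 -> ts1 = ts2 /\ w1 = w2.
Proof.
have [n] := ubnP (size (forest_code ts1)); elim: n => // n IH in ts1 ts2 *.
case: ts1 ts2 => [|[s1] ts1] [|[s2] ts2] //.
rewrite !forest_code_cons /= ltnS => sz [es] [ess] /IH -[||e ->] //.
  by rewrite !size_cat es ess.
by move/eqP: e; rewrite eqseq_cat// => /andP[/eqP-> /eqP->].
Qed.

Lemma code_prefix_inj t1 t2 w1 w2 :
  code t1 ++ w1 = code t2 ++ w2 -> t1 = t2.
Proof.
by rewrite -!forest_code1 => /forest_code_inj-[//|[->]].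
Qed.

Lemma code_inj : injective code.
Proof. by move=> t1 t2 e; apply: (@code_prefix_inj _ _ [::] [::]); rewrite !cats0. Qed.

Lemma code_prefix t i : i < nb_nodes t -> i <= sumn (take i (code t)).
Proof.
move=> ilt; have := @forest_code_prefix [:: t] i; rewrite forest_code1 size_code addn1 ltnS.
exact.
Qed.

(** Two rotations of codes that agree differ by a cut of a code in two
    proper nonempty parts; the prefix condition, applied to both codes, gives
    the two parts incompatible sums. *)
Lemma rot_code_inj t1 t2 i j : i < nb_nodes t1 -> j < nb_nodes t2 ->
  rot i (code t1) = rot j (code t2) -> t1 = t2 /\ i = j.
Proof.
wlog leij : t1 t2 i j / i <= j.
  move=> H i1 j2 e; case: (leqP i j) => [/H|/ltnW/H]; first exact.
  by move=> /(_ t2 t1 j2 i1 (esym e))[-> ->].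
move=> i1 j2 e.
have en : nb_nodes t1 = nb_nodes t2.
  by rewrite -!size_code -(size_rot i) e size_rot.
have {e} e : code t1 = rot (j - i) (code t2).
  apply: (@rot_inj i); rewrite e -rotD ?subnKC// size_code; lia.
have [ji|ji] := eqVneq j i.
  by move: e; rewrite ji subnn rot0 => /code_inj->.
exfalso; set d := j - i in e; have d0 : 0 < d by rewrite /d; move: ji leij; lia.
have dn : d < nb_nodes t2 by rewrite /d; lia.
have h2 := code_prefix dn.
have := @code_prefix t1 (nb_nodes t2 - d).
rewrite e en /rot take_size_cat ?size_drop ?size_code//.
have := sumn_code t2; rewrite -{1}(cat_take_drop d (code t2)) sumn_cat.
lia.
Qed.

(** The cut is made at the first time the walk with steps w_i - 1 attains its
    minimum over a period; the rotated word then satisfies the prefix condition. *)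
Lemma rot_code_surj w : size w = (sumn w).+1 ->
  exists t i, i < size w /\ rot i (code t) = w.
Proof.
move=> sw; set n := size w; have n0 : 0 < n by rewrite /n sw.
pose g j := sumn (take j w) + (n - j).
have [j jn jmin] : exists2 j, j < n & forall i, i < n ->
    g j <= g i /\ (i < j -> g j < g i).
  (* Lexicographic comparison of (g j, j): the minimizer of F is the first minimizer of g. *)
  pose F (j : 'I_n) := g j * n.+1 + j.
  have := @arg_minnP _ (Ordinal n0) xpredT F isT.
  case=> j _ jmin; exists j => // i ilt.
  have := jmin (Ordinal ilt) isT; rewrite /F /= => le.
  have jn := ltn_ord j.
  split=> [|ij]; rewrite leqNgt; apply/negP => lt.
    have : (g i).+1 * n.+1 <= g j * n.+1 by rewrite leq_mul2r lt orbT.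
    by rewrite mulSn; lia.
  have : g i * n.+1 <= g j * n.+1 by rewrite leq_mul2r -ltnS lt orbT.
  lia.
have sn : sumn w = n.-1 by rewrite /n sw.
have [|i|ts ts1 tsw] := @forest_code_surj (rot j w) 1.
- by rewrite size_rot addn1 sw /rot sumn_cat (addnC (sumn (drop _ _))) -sumn_cat cat_take_drop.
- rewrite size_rot -/n => ilt; rewrite addn1 ltnS /rot take_cat size_drop -/n.
  have gE k : k <= n -> sumn (take k w) + n = g k + k by rewrite /g; lia.
  case: ltnP => h.
    have e : sumn (take j w) + sumn (take i (drop j w)) = sumn (take (j + i) w).
      by rewrite takeD sumn_cat.
    have := (jmin (j + i) _).1; rewrite /g -e; lia.
  rewrite sumn_cat.
  have e : sumn (take j w) + sumn (drop j w) = n.-1.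
    by rewrite -sumn_cat cat_take_drop.
  rewrite take_takel; last lia.
  have lt1 : i - (n - j) < n by lia.
  have := (jmin _ lt1).2 ltac:(lia).
  rewrite /g; lia.
case: ts ts1 tsw => [|t []]// _; rewrite forest_code1 => tw.
exists t; case: (posnP j) => [j0|j0].
  by exists 0; split=> //; rewrite rot0 tw j0 rot0.
exists (n - j); split; first lia.
rewrite tw -rotD; last by rewrite -/n; lia.
by rewrite subnK ?rot_size// ltnW.
Qed.

(** A finite list that contains every tree with at most min(M,N) nodes and is
    stable enough for induction on N: degrees are less than M, heights less
    than N. *)
Fixpoint trees (M N : nat) : seq tree :=
  if N is N'.+1 then [seq Node s | i <- iota 0 M, s <- seqs (trees M N') i]
  else [::].

Lemma uniq_trees M N : uniq (trees M N).
Proof.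
elim: N => //= N IH; apply: allpairs_uniq_dep => //; first exact: iota_uniq.
  by move=> i _; apply: uniq_seqs.
move=> [i s] [j s'] /allpairsPdep[i0 [s0 [_ + [-> ->]]]]
  /allpairsPdep[j0 [s0' [_ + [-> ->]]]].
rewrite !mem_seqs => /andP[/eqP <- _] /andP[/eqP <- _] /= [->] //.
Qed.

Lemma nb_nodes_child s c : c \in s -> nb_nodes c < nb_nodes (Node s).
Proof.
move=> cs; rewrite /= ltnS.
elim: s cs => //= d s IH; rewrite inE => /predU1P[->|/IH h]; first exact: leq_addr.
exact: leq_trans h (leq_addl _ _).
Qed.

Lemma nb_nodes_gt0 t : 0 < nb_nodes t. Proof. by case: t. Qed.

Lemma nb_nodes_degree s : size s < nb_nodes (Node s).
Proof.
rewrite /= ltnS; elim: s => //= c s IH.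
by have := nb_nodes_gt0 c; lia.
Qed.

Lemma mem_trees M N t : nb_nodes t <= M -> nb_nodes t <= N -> t \in trees M N.
Proof.
elim: N t => [|N IH] [s] // sM sN.
apply/allpairsPdep; exists (size s), s; split=> //.
  by rewrite mem_iota add0n; apply: leq_trans sM; exact: nb_nodes_degree.
rewrite mem_seqs eqxx; apply/allP => c cs /=.
have := nb_nodes_child cs; move=> lt; apply: IH; last first.
  by rewrite -ltnS; exact: leq_trans sN.
exact: leq_trans (ltnW lt) sM.
Qed.

Definition words (K n x : nat) : seq (seq nat) :=
  [seq w <- seqs (iota 0 K) n | sumn w == x].

Lemma uniq_words K n x : uniq (words K n x).
Proof. by apply/filter_uniq/uniq_seqs/iota_uniq. Qed.

Lemma mem_words K n x w :
  (w \in words K n x) = [&& sumn w == x, size w == n & all (ltn^~ K) w].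
Proof.
by rewrite mem_filter mem_seqs; do 2!congr andb; apply: eq_all => i; rewrite /= mem_iota.
Qed.

Lemma leq_sumn (w : seq nat) a : a \in w -> a <= sumn w.
Proof.
by elim: w => //= b w IH; rewrite inE => /predU1P[->|/IH]; [exact: leq_addr|lia].
Qed.

Definition trees_of_size (n : nat) := [seq t <- trees n n | nb_nodes t == n].

Lemma mem_trees_of_size n t : (t \in trees_of_size n) = (nb_nodes t == n).
Proof.
rewrite mem_filter; case: eqP => //= e.
by rewrite mem_trees ?e.
Qed.

Lemma uniq_trees_of_size n : uniq (trees_of_size n).
Proof. exact/filter_uniq/uniq_trees. Qed.

(** Together with [uniq_cycle_lemma] this is the cycle lemma: a tree with n
    nodes and one of its n nodes correspond to a word of length n and sum n - 1. *)
Lemma mem_cycle_lemma n : 0 < n ->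
  [seq rot i (code t) | t <- trees_of_size n, i <- iota 0 n] =i words n n n.-1.
Proof.
move=> n0 w; rewrite mem_words; apply/allpairsP/and3P.
  case=> -[t i] /= []; rewrite mem_trees_of_size => /eqP tn; rewrite mem_iota add0n /= => iN ->.
  have sn : sumn (rot i (code t)) = n.-1.
    rewrite /rot sumn_cat addnC -sumn_cat cat_take_drop -tn.
    by rewrite -(sumn_code t).
  split; [by rewrite sn| |].
    by rewrite size_rot size_code tn.
  by apply/allP => a /leq_sumn; rewrite sn /=; lia.
move=> [/eqP sw /eqP wn _].
have [|t [i [iw e]]] := @rot_code_surj w; first by rewrite wn sw; lia.
exists (t, i); split=> //=; last by rewrite mem_iota add0n -wn.
by rewrite mem_trees_of_size -size_code -wn -e size_rot.
Qed.

Lemma uniq_cycle_lemma n :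
  uniq [seq rot i (code t) | t <- trees_of_size n, i <- iota 0 n].
Proof.
apply: allpairs_uniq; [exact: uniq_trees_of_size|exact: iota_uniq|].
move=> [t i] [t' i'] /allpairsP[[? ?] /= [+ + [-> ->]]] /allpairsP[[? ?] /= [+ + [-> ->]]].
rewrite !mem_trees_of_size !mem_iota /= !add0n => /eqP e1 i1 /eqP e2 i2 /rot_code_inj [||-> ->//].
  by rewrite e1.
by rewrite e2.
Qed.

(** * Junctions *)

(** The form of the recursion without maximum, on which all estimates rest. *)
Lemma horton_ge k s : (k < horton_strahler (Node s)) =
  has (fun c => k < horton_strahler c) s ||
  (2 <= count (fun c => k <= horton_strahler c) s).
Proof.
case: s => [|c0 s0]; first by [].
set s := c0 :: s0.
have -> : horton_strahler (Node s) =
  let h := map horton_strahler s in let m := foldr maxn 0 h in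
  m + (2 <= count_mem m h) by [].
move: s => s /=; set h := map _ _; set m := foldr _ _ _.
have hasE : has (fun c => k < horton_strahler c) s = (k < m).
  rewrite /m /h; elim: s {h m} => //= c s ->; by rewrite leq_max.
have mmax : all (geq m) h.
  rewrite /m; elim: h {hasE m} => //= a h; rewrite leq_maxl /=.
  by apply: sub_all => b /= ?; rewrite leq_max; apply/orP; right.
rewrite hasE; case: (ltngtP k m) => km /=.
- by rewrite (leq_trans km)// leq_addr.
- rewrite [X in _ = (1 < X)](_ : _ = 0); last first.
    apply/eqP; rewrite -leqn0 leqNgt -has_count; apply/hasP => -[c cs /=].
    have /= := allP mmax _ (map_f horton_strahler cs); lia.
  by case: (1 < count_mem m h); lia.
- have -> : count (fun c => k <= horton_strahler c) s = count_mem m h.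
    rewrite /h count_map; apply: eq_in_count => c cs /=.
    by have /= := allP mmax _ (map_f horton_strahler cs); lia.
  by rewrite km; case: (1 < _); lia.
Qed.

(** Nodes at which two subtrees of Horton-Strahler number at least k meet. Two
    independent rare events have to happen there, so the root of T is a junction
    with a probability of the order of P(H(T) >= k)^2. *)
Definition junction k (t : tree) : bool :=
  let: Node s := t in 2 <= count (fun c => k <= horton_strahler c) s.

Lemma infix_child s c : c \in s -> infix (code c) (code (Node s)).
Proof.
move=> cs; rewrite [code (Node s)]/= -cat1s; apply: infix_catl.
elim: s cs => // d s IH; rewrite inE [flatten _]/= => /predU1P[->|/IH h].
  exact: prefix_infix.
exact: infix_catl.
Qed.

Lemma has_junction k t : k < horton_strahler t ->
  exists2 a, junction k a & infix (code a) (code t).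
Proof.
elim/tree_memind: t => s IH; rewrite horton_ge => /orP[/hasP[c cs kc]|j].
  have [a ja ia] := IH c cs kc; exists a => //.
  exact: infix_trans ia (infix_child cs).
by exists (Node s) => //; exact: infix_refl.
Qed.

(** The smaller of two children satisfying p has at most half of the nodes. *)
Lemma two_children (p : pred tree) s : 2 <= count p s ->
  exists2 c, c \in s & p c /\ (nb_nodes c).*2 <= nb_nodes (Node s).
Proof.
move=> h.
have [c [c' [cs cs' pc pc' le]]] : exists c c',
    [/\ c \in s, c' \in s, p c, p c' & nb_nodes c + nb_nodes c' <= nb_nodes (Node s)].
  rewrite /=.
  elim: s h => //= c s IH; case: (boolP (p c)) => pc /=; last first.
    rewrite add0n => /IH[d [d' [ds ds' pd pd' le]]]; exists d, d'.
    by rewrite !inE ds ds' !orbT; split=> //; lia.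
  rewrite add1n ltnS -has_count => /hasP[d ds pd]; exists c, d.
  rewrite mem_head inE ds orbT; split=> //.
  by have := nb_nodes_child ds; rewrite /=; lia.
case: (leqP (nb_nodes c) (nb_nodes c')) => hc; [exists c|exists c'] => //; split=> //; lia.
Qed.

(** Descend to a node with two children of Horton-Strahler number above k and
    take a junction inside the smaller one. *)
Lemma small_junction k t : k.+1 < horton_strahler t ->
  exists2 a, junction k a & infix (code a) (code t) /\ (nb_nodes a).*2 <= nb_nodes t.
Proof.
elim/tree_memind: t => s IH; rewrite horton_ge => /orP[/hasP[c cs kc]|j].
  have [a ja [ia sa]] := IH c cs kc; exists a => //; split.
    exact: infix_trans ia (infix_child cs).
  by have := nb_nodes_child cs; lia.
have [c cs [kc sc]] := two_children j.
have [a ja ia] := has_junction kc; exists a => //; split.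
  exact: infix_trans ia (infix_child cs).
by have := size_infix ia; rewrite !size_code; lia.
Qed.

(** A subtree occurs as a factor of the code, and rotating the code to the
    position of its root makes it a prefix. *)
Lemma infix_rot a t : infix (code a) (code t) ->
  exists2 i, i < nb_nodes t & prefix (code a) (rot i (code t)).
Proof.
move=> /infixP[u [w e]]; exists (size u).
  by rewrite -(size_code t) e !size_cat (size_code a) -[ltnLHS]addn0 ltn_add2l addn_gt0 nb_nodes_gt0.
by rewrite e rot_size_cat -catA prefix_prefix.
Qed.

Local Open Scope classical_set_scope.
Local Open Scope ring_scope.

(** * Weights of sequences, trees and words *)

Section Weights.
Context {R : realFieldType}.
Implicit Types a : nat -> R.

Lemma ler_sum_subset (T : eqType) (s1 s2 : seq T) (F : T -> R) : uniq s1 ->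
  {subset s1 <= s2} -> (forall x, 0 <= F x) ->
  \sum_(x <- s1) F x <= \sum_(x <- s2) F x.
Proof.
elim: s1 s2 => [|x s1 IH] s2 /=.
  by move=> _ _ F0; rewrite big_nil sumr_ge0.
move=> /andP[xs1 us1] sub F0; have xs2 : x \in s2 by rewrite sub ?mem_head.
rewrite big_cons (perm_big _ (perm_to_rem xs2)) big_cons lerD2l IH// => y ys1.
have := sub y; rewrite inE ys1 orbT => /(_ isT).
rewrite (perm_mem (perm_to_rem xs2)) inE => /predU1P[yx|//].
by rewrite -yx ys1 in xs1.
Qed.

Lemma big_seqsS (T : Type) (s : seq T) n (P : pred (seq T)) (F : seq T -> R) :
  \sum_(l <- seqs s n.+1 | P l) F l =
  \sum_(c <- s) \sum_(l <- seqs s n | P (c :: l)) F (c :: l).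
Proof.
rewrite /= big_mkcond /= big_allpairs_dep /=; apply: eq_bigr => c _.
by rewrite [RHS]big_mkcond.
Qed.

Section WeightedSeqs.
Context {T : Type} (s : seq T) (f : T -> R) (f_ge0 : forall c, 0 <= f c).

(** The measure of g for the product measure with density f on sequences of
    length n over s. *)
Definition seq_sum n (g : pred (seq T)) : R :=
  \sum_(l <- seqs s n | g l) \prod_(c <- l) f c.

Definition letter_sum (p : pred T) : R := \sum_(c <- s | p c) f c.

Lemma prod_weight_ge0 l : 0 <= \prod_(c <- l) f c.
Proof. by rewrite prodr_ge0. Qed.

Lemma seq_sum_ge0 n g : 0 <= seq_sum n g.
Proof. by rewrite sumr_ge0// => l _; exact: prod_weight_ge0. Qed.

Lemma letter_sum_ge0 p : 0 <= letter_sum p. Proof. by rewrite sumr_ge0. Qed.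

Lemma letter_sum_sub p q : subpred p q -> letter_sum p <= letter_sum q.
Proof.
move=> pq; rewrite /letter_sum [leLHS]big_mkcond [leRHS]big_mkcond ler_sum// => c _.
by case: ifP => [/pq->|]//; case: ifP.
Qed.

Lemma seq_sumS n g : seq_sum n.+1 g = \sum_(c <- s) f c * seq_sum n (fun l => g (c :: l)).
Proof.
rewrite /seq_sum big_seqsS; apply: eq_bigr => c _.
by rewrite big_distrr /=; apply: eq_bigr => l _; rewrite big_cons.
Qed.

Lemma seq_sum0 g : seq_sum 0 g = (g [::])%:R.
Proof. by rewrite /seq_sum /= big_mkcond big_seq1 big_nil; case: (g _). Qed.

Lemma eq_seq_sum n g g' : g =1 g' -> seq_sum n g = seq_sum n g'.
Proof. by move=> e; exact: eq_bigl. Qed.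

Lemma seq_sumT n : seq_sum n xpredT = (letter_sum xpredT) ^+ n.
Proof.
elim: n => [|n IH]; first by rewrite seq_sum0 expr0.
by rewrite seq_sumS /= IH -big_distrl /= exprS.
Qed.

Lemma seq_sum_false n g : g =1 xpred0 -> seq_sum n g = 0.
Proof. by move=> g0; rewrite /seq_sum big_pred0. Qed.

Context (p1 p2 : pred T) (p21 : subpred p2 p1).

(** Conditioning on the first letter, for two nested events p2 and p1 about
    a letter. *)
Lemma seq_sum_rec n g g1 g2 g3 :
  (forall c l, g (c :: l) = if p2 c then g3 l else if p1 c then g2 l else g1 l) ->
  seq_sum n.+1 g = (letter_sum xpredT - letter_sum p1) * seq_sum n g1 +
    (letter_sum p1 - letter_sum p2) * seq_sum n g2 + letter_sum p2 * seq_sum n g3.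
Proof.
move=> gE; rewrite seq_sumS.
rewrite (_ : letter_sum xpredT - letter_sum p1 = \sum_(c <- s) (~~ p1 c)%:R * f c); last first.
  apply/eqP; rewrite subr_eq /letter_sum [X in _ + X]big_mkcond -big_split /=; apply/eqP.
  by apply: eq_bigr => c _; case: (p1 c); rewrite ?mul0r ?mul1r ?add0r ?addr0.
rewrite (_ : letter_sum p1 - letter_sum p2 = \sum_(c <- s) (p1 c && ~~ p2 c)%:R * f c); last first.
  apply/eqP; rewrite subr_eq /letter_sum [X in _ + X]big_mkcond [eqbLHS]big_mkcond -big_split /=.
  apply/eqP; apply: eq_bigr => c _; have := @p21 c.
  by case: (p1 c); case: (p2 c) => [/(_ isT)|_]//; rewrite ?mul0r ?mul1r ?add0r ?addr0.
rewrite (_ : letter_sum p2 = \sum_(c <- s) (p2 c)%:R * f c); last first.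
  rewrite /letter_sum big_mkcond; apply: eq_bigr => c _.
  by case: (p2 c); rewrite ?mul0r ?mul1r.
rewrite !big_distrl /= -!big_split /=; apply: eq_bigr => c _.
rewrite (eq_seq_sum n (gE c)); have := @p21 c.
by case: (p2 c) => [->//|_]; case: (p1 c) => //=; ring.
Qed.

Let one (l : seq T) := has p1 l.
Let two (l : seq T) := (2 <= count p1 l)%N.
Let bad (l : seq T) := has p2 l || two l.

Lemma seq_sum_one_rec n : seq_sum n.+1 one =
  (letter_sum xpredT - letter_sum p1) * seq_sum n one + letter_sum p1 * (letter_sum xpredT) ^+ n.
Proof.
rewrite -seq_sumT (@seq_sum_rec _ one one xpredT xpredT).
  by rewrite -addrA -mulrDl subrK.
by move=> c l; rewrite /one /=; case: ifP => [/p21->//|_]; case: ifP.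
Qed.

Lemma seq_sum_two_rec n : seq_sum n.+1 two =
  (letter_sum xpredT - letter_sum p1) * seq_sum n two + letter_sum p1 * seq_sum n one.
Proof.
rewrite (@seq_sum_rec _ two two one one); first by rewrite -addrA -mulrDl subrK.
move=> c l; rewrite /two /one /=; case: ifP => [/p21->|_].
  by rewrite has_count.
by case: ifP => // _; rewrite has_count.
Qed.

Lemma seq_sum_bad_rec n : seq_sum n.+1 bad =
  (letter_sum xpredT - letter_sum p1) * seq_sum n bad + (letter_sum p1 - letter_sum p2) * seq_sum n one
   + letter_sum p2 * (letter_sum xpredT) ^+ n.
Proof.
rewrite -seq_sumT; apply: seq_sum_rec => c l; rewrite /bad /two /one /=.
case: ifP => //= p2c; have := @p21 c; case: ifP => //= p1c _.
rewrite add1n ltnS -has_count orb_idl//.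
exact: sub_has.
Qed.

Lemma seq_sum_none n : seq_sum n (fun l => ~~ one l) = (letter_sum xpredT - letter_sum p1) ^+ n.
Proof.
elim: n => [|n IH]; first by rewrite seq_sum0.
rewrite (@seq_sum_rec _ _ (fun l => ~~ one l) xpred0 xpred0); last first.
  by move=> c l; rewrite /one /=; case: ifP => [/p21->//|_]; case: ifP.
by rewrite (seq_sum_false n (g:=xpred0))// !mulr0 !addr0 IH exprS.
Qed.

Lemma seq_sum_good_rec n : seq_sum n.+1 (fun l => ~~ bad l) =
  (letter_sum xpredT - letter_sum p1) * seq_sum n (fun l => ~~ bad l) +
  (letter_sum p1 - letter_sum p2) * (letter_sum xpredT - letter_sum p1) ^+ n.
Proof.
rewrite -seq_sum_none.
rewrite (@seq_sum_rec _ _ (fun l => ~~ bad l) (fun l => ~~ one l) xpred0).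
  by rewrite (seq_sum_false n (g:=xpred0))// !mulr0 !addr0.
move=> c l; rewrite /bad /two /one /=.
case: ifP => //= p2c; have := @p21 c; case: ifP => //= p1c _.
rewrite add1n ltnS -has_count orb_idl//.
exact: sub_has.
Qed.

End WeightedSeqs.

(** For independent letters, the weight of the sequences of length i in which
    all letters have a type of weight A except at most one, of weight B. *)
Definition one_exception (i : nat) (A B : R) : R := A ^+ i + i%:R * B * A ^+ i.-1.

Lemma one_exceptionS i A B : one_exception i.+1 A B = A * one_exception i A B + B * A ^+ i.
Proof.
rewrite /one_exception; case: i => [|i] /=; first by rewrite !expr0; ring.
by rewrite -(natr1 i.+1) !exprS; ring.
Qed.

Section Bounds.
Context {T : Type} (s : seq T) (f : T -> R) (f_ge0 : forall c, 0 <= f c).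
Context (p1 p2 : pred T) (p21 : subpred p2 p1).
Let bad (l : seq T) := has p2 l || (2 <= count p1 l)%N.

(** If c ranges over trees, p1 c means H(c) >= k and p2 c means H(c) > k, the
    good sequences of children are those for which the parent has H <= k. *)
Lemma seq_sum_good_le n A B : letter_sum s f (fun c => ~~ p1 c) <= A ->
  letter_sum s f (fun c => ~~ p2 c) <= A + B -> 0 <= B ->
  seq_sum s f n (fun l => ~~ bad l) <= one_exception n A B.
Proof.
have letter_sumC p : letter_sum s f (fun c => ~~ p c) = letter_sum s f xpredT - letter_sum s f p.
  by rewrite /letter_sum [X in _ = X - _](bigID p) /= addrC addrK.
rewrite !letter_sumC; set Q := letter_sum s f xpredT; set u := letter_sum _ _ p1; set u' := letter_sum _ _ p2.
have Qu : 0 <= Q - u by rewrite -letter_sumC letter_sum_ge0.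
move=> uA u'A B0; have A0 : 0 <= A by exact: le_trans uA.
suff H m : (Q - u) ^+ m <= seq_sum s f m (fun l => ~~ bad l) <= one_exception m A B.
  by have /andP[] := H n.
elim: m => [|m /andP[IH1 IH2]].
  by rewrite seq_sum0 /one_exception !mul0r addr0 !expr0 lexx.
rewrite seq_sum_good_rec// -/Q -/u -/u' one_exceptionS exprS; apply/andP; split.
  have uu' : 0 <= u - u' by rewrite subr_ge0 /u /u' letter_sum_sub.
  have : 0 <= (u - u') * (Q - u) ^+ m by rewrite mulr_ge0// exprn_ge0.
  have : (Q - u) * (Q - u) ^+ m <= (Q - u) * seq_sum s f m (fun l => ~~ bad l).
    by rewrite ler_wpM2l.
  lra.
set G := seq_sum _ _ _ _ in IH1 IH2 *; set X := (Q - u) ^+ m in IH1 *.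
have X0 : 0 <= X by rewrite exprn_ge0.
have XA : X <= A ^+ m by rewrite lerXn2r.
have AD : A ^+ m <= one_exception m A B.
  by rewrite /one_exception lerDl !mulr_ge0// exprn_ge0.
set Y := A ^+ m in XA AD *; set D := one_exception m A B in IH2 AD *.
have h1 : (Q - u) * (G - X) <= (Q - u) * (D - X) by rewrite ler_wpM2l// lerD2r.
have h2 : (Q - u') * X <= (A + B) * X by rewrite ler_wpM2r.
have h3 : (A + B - (Q - u)) * X <= (A + B - (Q - u)) * Y.
  rewrite ler_wpM2l//; lra.
have h4 : (Q - u) * (D - Y) <= A * (D - Y) by rewrite ler_wpM2r// subr_ge0.
lra.
Qed.

Context (Q1 : letter_sum s f xpredT <= 1).

Lemma seq_sum_one_le n b : letter_sum s f p1 <= b -> b <= 1 ->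
  seq_sum s f n (has p1) <= 1 - (1 - b) ^+ n.
Proof.
move=> ub b1; have Q1' := Q1; set Q := letter_sum s f xpredT in Q1' *; set u := letter_sum s f p1 in ub *.
have u0 : 0 <= u by exact: letter_sum_ge0.
have Q0 : 0 <= Q by exact: letter_sum_ge0.
have uQ : u <= Q by apply: letter_sum_sub.
elim: n => [|n IH]; first by rewrite seq_sum0 expr0 subrr.
rewrite (seq_sum_one_rec s f p21) -/Q -/u exprS.
set W := seq_sum _ _ _ _ in IH *; set E := (1 - b) ^+ n in IH *.
have W0 : 0 <= W by exact: seq_sum_ge0.
have E0 : 0 <= E by rewrite exprn_ge0// subr_ge0.
have h1 : (Q - u) * W <= (1 - u) * W by rewrite ler_wpM2r// lerD2r.
have h2 : (1 - u) * W <= (1 - u) * (1 - E) by rewrite ler_wpM2l// subr_ge0; lra.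
have h3 : u * Q ^+ n <= u * 1 by rewrite ler_wpM2l// exprn_ile1.
have h4 : u * E <= b * E by rewrite ler_wpM2r.
lra.
Qed.

(** The complementary event, estimated directly: the total weight of the
    letters may be less than 1, so passing to the complement of
    [seq_sum_good_le] would point the wrong way. *)
Lemma seq_sum_bad_le n b b' : letter_sum s f p1 <= b -> letter_sum s f p2 <= b' ->
  0 <= b' -> b' <= b -> b <= 1 ->
  seq_sum s f n bad <= 1 - one_exception n (1 - b) (b - b').
Proof.
move=> ub u'b' b'0 b'b b1.
have Q1' := Q1; set Q := letter_sum s f xpredT in Q1' *; set u := letter_sum s f p1 in ub; set u' := letter_sum s f p2 in u'b'.
have u'0 : 0 <= u' by exact: letter_sum_ge0.
have Q0 : 0 <= Q by exact: letter_sum_ge0.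
have u'u : u' <= u by apply: letter_sum_sub.
have uQ : u <= Q by apply: letter_sum_sub.
elim: n => [|n IH]; first by rewrite seq_sum0 /one_exception !mul0r expr0 addr0 subrr.
rewrite seq_sum_bad_rec// -/Q -/u -/u' one_exceptionS.
have := @seq_sum_one_le n b ub b1.
set V := seq_sum _ _ _ (has _); set W := seq_sum _ _ _ bad in IH *.
have : (1 - b) ^+ n <= one_exception n (1 - b) (b - b').
  by rewrite /one_exception lerDl !mulr_ge0// ?exprn_ge0 ?subr_ge0.
have : 0 <= (1 - b) ^+ n by rewrite exprn_ge0// subr_ge0.
set D := one_exception _ _ _ in IH *; set E := _ ^+ n => E0 ED VE.
have W0 : 0 <= W by exact: seq_sum_ge0.
have h1 : (Q - u) * W <= (1 - u) * W by rewrite ler_wpM2r// lerD2r.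
have h2 : (1 - u) * W <= (1 - u) * (1 - D) by rewrite ler_wpM2l// subr_ge0; lra.
have h3 : u' * Q ^+ n <= u' * 1 by rewrite ler_wpM2l// exprn_ile1.
have h4 : (u - u') * V <= (u - u') * (1 - E) by rewrite ler_wpM2l// subr_ge0.
have h5 : u * (D - E) <= b * (D - E) by rewrite ler_wpM2r// subr_ge0.
have h6 : u' * E <= b' * E by rewrite ler_wpM2r.
lra.
Qed.

Lemma seq_sum_two_le n b : letter_sum s f p1 <= b ->
  seq_sum s f n (fun l => (2 <= count p1 l)%N) <= 'C(n, 2)%:R * b ^+ 2.
Proof.
move=> ub; have Q1' := Q1; set Q := letter_sum s f xpredT in Q1' *; set u := letter_sum s f p1 in ub.
have u0 : 0 <= u by exact: letter_sum_ge0.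
have b0 : 0 <= b by exact: le_trans ub.
have Q0 : 0 <= Q by exact: letter_sum_ge0.
have uQ : u <= Q by apply: letter_sum_sub.
have one m : seq_sum s f m (has p1) <= m%:R * b.
  elim: m => [|m IH]; first by rewrite seq_sum0 mul0r.
  rewrite (seq_sum_one_rec s f p21) -/Q -/u -natr1.
  set W := seq_sum _ _ _ _ in IH *; have W0 : 0 <= W by exact: seq_sum_ge0.
  have h1 : (Q - u) * W <= 1 * W by rewrite ler_wpM2r//; lra.
  have h3 : u * Q ^+ m <= u * 1 by rewrite ler_wpM2l// exprn_ile1.
  lra.
elim: n => [|n IH]; first by rewrite seq_sum0 mul0r.
rewrite (seq_sum_two_rec s f p21) -/Q -/u binS bin1 natrD.
have := one n; set V := seq_sum _ _ _ (has _) => Vn.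
set W := seq_sum _ _ _ _ in IH *; have W0 : 0 <= W by exact: seq_sum_ge0.
have V0 : 0 <= V by exact: seq_sum_ge0.
have h1 : (Q - u) * W <= 1 * W by rewrite ler_wpM2r//; lra.
have h2 : u * V <= b * (n%:R * b) by rewrite ler_pM.
rewrite mulrDl; lra.
Qed.

End Bounds.

Definition wword a (w : seq nat) : R := \prod_(i <- w) a i.
Definition wtree a (t : tree) : R := wword a (code t).

Lemma wtree_node a s : wtree a (Node s) = a (size s) * \prod_(c <- s) wtree a c.
Proof.
rewrite /wtree /wword /= big_cons; congr (_ * _).
by rewrite big_flatten big_map.
Qed.

Lemma wword_ge0 a w : (forall i, 0 <= a i) -> 0 <= wword a w.
Proof. by move=> a0; rewrite prodr_ge0. Qed.

Lemma wtree_ge0 a t : (forall i, 0 <= a i) -> 0 <= wtree a t.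
Proof. exact: wword_ge0. Qed.

(** The factor z marks the nodes, which turns sums of weights into generating
    functions in the number of nodes. *)
Lemma wtree_scale z a t : wtree (fun i => z * a i) t = z ^+ nb_nodes t * wtree a t.
Proof.
rewrite /wtree /wword big_split /= -size_code; congr (_ * _).
by elim: (code t) => [|i w IH]; rewrite ?big_nil// big_cons IH exprS.
Qed.

Lemma sum_iota (M : nat) (F : nat -> R) : \sum_(i <- iota 0 M) F i = \sum_(i < M) F i.
Proof. by rewrite -(big_mkord xpredT) /index_iota subn0. Qed.

Lemma sum_treesS a M N (Q : pred tree) :
  \sum_(t <- trees M N.+1 | Q t) wtree a t =
  \sum_(i < M) a i * seq_sum (trees M N) (wtree a) i (fun s => Q (Node s)).
Proof.
rewrite /= big_mkcond big_allpairs_dep /= sum_iota; apply: eq_bigr => i _.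
rewrite /seq_sum big_distrr /= [RHS]big_mkcond /= big_seq_cond [RHS]big_seq_cond.
apply: eq_bigr => s; rewrite mem_seqs andbT => /andP[/eqP si _].
by case: ifP => // _; rewrite wtree_node si.
Qed.

Section Recursions.
Context (a : nat -> R) (M : nat) (a_ge0 : forall i, 0 <= a i).

Lemma sum_trees_le1 N : \sum_(i < M) a i <= 1 ->
  letter_sum (trees M N) (wtree a) xpredT <= 1.
Proof.
move=> a1; elim: N => [|N IH]; first by rewrite /letter_sum big_nil.
rewrite /letter_sum sum_treesS; apply: le_trans a1; apply: ler_sum => i _.
rewrite seq_sumT -[leRHS]mulr1 ler_wpM2l// exprn_ile1//.
by apply: letter_sum_ge0 => t; exact: wtree_ge0.
Qed.

(** Any sequence b that satisfies the tail recursion with an inequality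
    dominates the tail: by induction on k, then on the height N, since the
    recursion for k+1 involves the tail at k+1 for the children. *)
Lemma horton_ge_supersolution (b : nat -> R) : \sum_(i < M) a i <= 1 ->
  b 0 = 1 -> (forall k, 0 <= b k.+1 <= b k) ->
  (forall k, \sum_(i < M) a i * (1 - one_exception i (1 - b k) (b k - b k.+1)) <= b k.+1) ->
  forall k N, \sum_(t <- trees M N | (k <= horton_strahler t)%N) wtree a t <= b k.
Proof.
move=> a1 b0 bdec hb; have b1 k : b k <= 1.
  by elim: k => [|k IH]; rewrite ?b0//; have /andP[_ h] := bdec k; exact: le_trans h IH.
have wt0 t := wtree_ge0 t a_ge0.
elim=> [|k IHk] N; first by rewrite b0; exact: sum_trees_le1.
have /andP[bk0 bk] := bdec k.
elim: N => [|N IH]; first by rewrite big_nil.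
rewrite sum_treesS; apply: le_trans (hb k); apply: ler_sum => i _.
rewrite ler_wpM2l// (eq_seq_sum _ _ _ (horton_ge k)).
apply: seq_sum_bad_le => //; first by move=> t /ltnW.
exact: sum_trees_le1.
exact: IHk.
Qed.

(** With a_i = z p_i and z > 1 this bounds generating functions in the number
    of nodes beyond z = 1, where the total mass of all trees may be infinite. *)
Lemma horton_lt_supersolution (A : nat -> R) (K : nat) : 0 <= A 0 ->
  (forall k, (k < K)%N -> A k <= A k.+1) ->
  (forall k, (k < K)%N -> \sum_(i < M) a i * one_exception i (A k) (A k.+1 - A k) <= A k.+1) ->
  forall N, \sum_(t <- trees M N | (horton_strahler t < K)%N) wtree a t <= A K.
Proof.
move=> A0 Ainc hA; have wt0 t := wtree_ge0 t a_ge0.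
have H k : (k <= K)%N -> 0 <= A k.
  by elim: k => // k IH kK; apply: le_trans (Ainc k kK); exact/IH/ltnW.
suff G k : (k <= K)%N -> forall N,
    \sum_(t <- trees M N | (horton_strahler t < k)%N) wtree a t <= A k by exact: G.
elim: k => [|k IHk] kK N; first by rewrite big_pred0.
elim: N => [|N IH]; first by rewrite big_nil H.
rewrite sum_treesS; apply: le_trans (hA k kK); apply: ler_sum => i _.
rewrite ler_wpM2l//.
rewrite (eq_seq_sum _ _ _ (fun s => etrans (ltnNge _ _) (congr1 negb (horton_ge k s)))).
apply: seq_sum_good_le => //.
- by move=> t /ltnW.
- by under [letter_sum _ _ _]eq_bigl do rewrite -ltnNge; exact: IHk (ltnW kK) N.
- rewrite subrKC; by under [letter_sum _ _ _]eq_bigl do rewrite -leqNgt; exact: IH.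
- by rewrite subr_ge0 Ainc.
Qed.

Lemma junction_le k (b v : R) : \sum_(i < M) a i <= 1 ->
  (forall N, \sum_(t <- trees M N | (k <= horton_strahler t)%N) wtree a t <= b) ->
  \sum_(i < M) a i * 'C(i, 2)%:R <= v ->
  forall N, \sum_(t <- trees M N | junction k t) wtree a t <= v * b ^+ 2.
Proof.
move=> a1 hb hv N; have wt0 t := wtree_ge0 t a_ge0.
have v0 : 0 <= v by apply: le_trans hv; rewrite sumr_ge0// => i _; rewrite mulr_ge0.
case: N => [|N]; first by rewrite big_nil mulr_ge0// sqr_ge0.
rewrite sum_treesS; apply: (@le_trans _ _ (\sum_(i < M) a i * 'C(i, 2)%:R * b ^+ 2)).
  apply: ler_sum => i _; rewrite -mulrA ler_wpM2l//.
  apply: (@seq_sum_two_le _ _ _ wt0 (fun t => k <= horton_strahler t)%N xpred0) => //.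
    exact: sum_trees_le1.
  exact: hb.
by rewrite -big_distrl /= ler_wpM2r// sqr_ge0.
Qed.

End Recursions.

Section CycleLemma.
Context (a : nat -> R) (a_ge0 : forall i, 0 <= a i).

(** The probability that the random walk with step law a is at x at time n, the
    steps being truncated at K. *)
Definition walk K n x : R := \sum_(w <- words K n x) wword a w.

Lemma wword_rot i w : wword a (rot i w) = wword a w.
Proof. by rewrite /wword (perm_big w)// perm_rot. Qed.

Lemma sum_cycle n (P : pred (seq nat)) : (0 < n)%N ->
  \sum_(w <- words n n n.-1 | P w) wword a w =
  \sum_(t <- trees_of_size n) \sum_(i < n | P (rot i (code t))) wtree a t.
Proof.
move=> n0; rewrite (perm_big [seq rot i (code t) | t <- trees_of_size n, i <- iota 0 n]); last first.
  by apply: uniq_perm; [exact: uniq_words|exact: uniq_cycle_lemma|]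
     => w; rewrite mem_cycle_lemma.
rewrite big_mkcond big_allpairs_dep /=; apply: eq_bigr => t _.
rewrite (sum_iota n (fun i => if P (rot i (code t)) then wword a (rot i (code t)) else 0)).
by rewrite [RHS]big_mkcond; apply: eq_bigr => i _; rewrite wword_rot.
Qed.

Lemma walk_cycle n : (0 < n)%N ->
  walk n n n.-1 = n%:R * \sum_(t <- trees_of_size n) wtree a t.
Proof.
move=> n0; rewrite /walk (sum_cycle xpredT)// big_distrr /=.
by apply: eq_bigr => t _; rewrite sumr_const card_ord mulr_natl.
Qed.

(** After the code of t, the rest of the word is arbitrary of length n - |t| and
    sum n - |t|. *)
Lemma sum_words_prefix n t : (nb_nodes t <= n)%N ->
  \sum_(w <- words n n n.-1 | prefix (code t) w) wword a w <=
  wtree a t * walk n (n - nb_nodes t) (n - nb_nodes t).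
Proof.
move=> tn; rewrite -big_filter.
rewrite (_ : wtree a t * _ =
  \sum_(w <- [seq code t ++ w | w <- words n (n - nb_nodes t) (n - nb_nodes t)]) wword a w).
  apply: ler_sum_subset; [exact/filter_uniq/uniq_words| |by move=> w; exact: wword_ge0].
  move=> w; rewrite mem_filter => /andP[/prefixP[v ->]].
  rewrite mem_words sumn_cat size_cat all_cat size_code => /and3P[sv nv /andP[_ av]].
  apply: map_f; rewrite mem_words av andbT.
  have := sumn_code t; move: sv nv tn (nb_nodes_gt0 t); lia.
rewrite big_map /walk big_distrr /=; apply: eq_bigr => w _.
by rewrite /wtree /wword big_cat.
Qed.

(** Union bound over the occurrences of subtrees in A, counted through the cycle
    lemma. *)
Lemma fringe_union_bound n (A B : pred tree) : (0 < n)%N ->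
  (forall t, nb_nodes t = n -> B t -> exists2 u, A u &
     infix (code u) (code t)) ->
  \sum_(t <- trees_of_size n | B t) wtree a t <=
  \sum_(u <- trees n n | A u && (nb_nodes u <= n)%N)
     wtree a u * walk n (n - nb_nodes u) (n - nb_nodes u).
Proof.
move=> n0 hB; have wt0 t := wtree_ge0 t a_ge0; have ww0 w := wword_ge0 w a_ge0.
pose P w := has (fun u => [&& A u, (nb_nodes u <= n)%N & prefix (code u) w]) (trees n n).
apply: (@le_trans _ _ (\sum_(w <- words n n n.-1 | P w) wword a w)).
  rewrite (sum_cycle P)// big_mkcond big_seq [leRHS]big_seq ler_sum// => t.
  rewrite mem_trees_of_size => /eqP tn; case: ifP => [Bt|_]; last exact: sumr_ge0.
  have [u Au iu] := hB t tn Bt; have [i it pi] := infix_rot iu.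
  rewrite tn in it; rewrite (bigD1 (Ordinal it)) /=; last first.
    have un : (nb_nodes u <= n)%N by rewrite -tn -!size_code; exact: size_infix iu.
    by apply/hasP; exists u; rewrite ?mem_trees// Au un pi.
  by rewrite lerDl sumr_ge0.
apply: (@le_trans _ _ (\sum_(u <- trees n n | A u && (nb_nodes u <= n)%N)
   \sum_(w <- words n n n.-1 | prefix (code u) w) wword a w)); last first.
  by apply: ler_sum => u /andP[_ un]; exact: sum_words_prefix.
under [leRHS]eq_bigr => u _ do rewrite big_mkcond.
rewrite exchange_big /= big_mkcond; apply: ler_sum => w _.
case: ifP => [/hasP[u ut /and3P[Au un pu]]|_]; last first.
  by apply: sumr_ge0 => u _; case: ifP.
rewrite (big_rem _ ut) /= Au un pu lerDl sumr_ge0// => v _.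
by case: ifP.
Qed.

End CycleLemma.
End Weights.

(** * The scalar recursion for the Horton-Strahler tail *)

Section OneVariable.
Context {R : realType}.

Lemma bernoulli_lower (s : R) m : 0 <= s <= 1 -> 1 - m%:R * s <= (1 - s) ^+ m.
Proof.
move=> /andP[s0 s1]; elim: m => [|m IH]; first by rewrite mul0r subr0 expr0.
rewrite exprS -natr1.
have h : (1 - s) * (1 - m%:R * s) <= (1 - s) * (1 - s) ^+ m.
  by rewrite ler_wpM2l// subr_ge0.
have h2 : 0 <= m%:R * s * s by rewrite !mulr_ge0.
lra.
Qed.

Lemma bernoulli_upper (s : R) m : 0 <= s <= 1 ->
  (1 - s) ^+ m <= 1 - m%:R * s + 'C(m, 2)%:R * s ^+ 2.
Proof.
move=> /andP[s0 s1]; elim: m => [|m IH]; first by rewrite !mul0r subr0 addr0 expr0.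
rewrite exprS binS bin1 natrD -natr1.
have h : (1 - s) * (1 - s) ^+ m <= (1 - s) * (1 - m%:R * s + 'C(m, 2)%:R * s ^+ 2).
  by rewrite ler_wpM2l// subr_ge0.
have h2 : 0 <= 'C(m, 2)%:R * s ^+ 2 * s by rewrite !mulr_ge0// sqr_ge0.
apply: le_trans h _; rewrite -subr_ge0.
rewrite (_ : _ - _ = 'C(m, 2)%:R * s ^+ 2 * s)//; ring.
Qed.

Lemma bin2_natr m : 'C(m.+1, 2)%:R = m.+1%:R * m%:R / 2 :> R.
Proof.
apply: (@mulIf _ 2); first by rewrite pnatr_eq0.
by rewrite divfK ?pnatr_eq0// -!natrM mulnC mul2n bin2 even_halfK// oddM /=; case: (odd m).
Qed.

(** The probability that at least two of i independent events of probability s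
    occur. *)
Definition collision (i : nat) (s : R) : R := 1 - one_exception i (1 - s) s.

(** Averaged over the offspring law, this is f'(1) - f'(1-s). *)
Definition drift (i : nat) (s : R) : R := i%:R * (1 - (1 - s) ^+ i.-1).

(** With s and s' for the probabilities that a child has H >= k and H > k, the
    left-hand side is the probability that a root of degree i has H <= k. *)
Lemma one_exceptionE i (s s' : R) :
  one_exception i (1 - s) (s - s') = 1 - collision i s - s' * (i%:R - drift i s).
Proof. by rewrite /collision /drift /one_exception; ring. Qed.

(** Averaged over i, the right-hand side is f(1-s) - (1-s), the gap between the
    generating function and its tangent at 1. *)
Lemma collision_drift i (s : R) : s * drift i s - collision i s = (1 - s) ^+ i - 1 + i%:R * s.
Proof. by rewrite /collision /drift /one_exception; ring. Qed.

Lemma collisionS m (s : R) : collision m.+1 s = 1 - (1 - s) ^+ m * (1 + m%:R * s).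
Proof. by rewrite /collision /one_exception exprS -natr1 /=; ring. Qed.

Lemma drift_le i (s : R) : 0 <= s <= 1 -> drift i s <= i%:R * i.-1%:R * s.
Proof.
move=> s01; rewrite /drift -mulrA ler_wpM2l//.
by have := bernoulli_lower i.-1 s01; lra.
Qed.

Lemma drift_ge0 i (s : R) : 0 <= s <= 1 -> 0 <= drift i s.
Proof.
move=> /andP[s0 s1]; rewrite mulr_ge0// subr_ge0 exprn_ile1//; lra.
Qed.

Lemma collision_ge0 i (s : R) : 0 <= s <= 1 -> 0 <= collision i s.
Proof.
case: i => [|m] s01; first by rewrite /collision /one_exception expr0 !mul0r addr0 subrr.
move/andP: (s01) => [s0 s1].
have := bernoulli_lower m s01.
rewrite collisionS subr_ge0 => _.
elim: m => [|m IH]; first by rewrite mul0r addr0 expr0 mulr1.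
rewrite exprS -natr1.
have h : (1 - s) * (1 + (m%:R + 1) * s) <= 1 + m%:R * s.
  have : 0 <= s * s * (m%:R + 1) by rewrite !mulr_ge0// addr_ge0.
  lra.
apply: le_trans IH; rewrite mulrAC mulrC ler_wpM2l//.
by rewrite exprn_ge0// subr_ge0.
Qed.

Lemma collision_le i (s : R) : 0 <= s <= 1 -> collision i s <= 'C(i, 2)%:R * s ^+ 2.
Proof.
case: i => [|m] s01; first by rewrite /collision /one_exception expr0 !mul0r addr0 subrr.
rewrite collisionS bin2_natr; move/andP: (s01) => [s0 s1].
elim: m => [|m IH]; first by rewrite mulr0 !mul0r addr0 expr0 mulr1 subrr.
have hb := bernoulli_lower m s01.
have : (1 - s) ^+ m.+1 * (1 + m.+1%:R * s) =
       (1 - s) ^+ m * (1 + m%:R * s) - (1 - s) ^+ m * (m.+1%:R * s ^+ 2).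
  by rewrite exprS -natr1; ring.
move=> ->.
have h : (1 - s) ^+ m * (m.+1%:R * s ^+ 2) <= 1 * (m.+1%:R * s ^+ 2).
  rewrite ler_wpM2r ?mulr_ge0 ?sqr_ge0// exprn_ile1//; lra.
move: IH h; rewrite -(natr1 m.+1) -natr1; set X := _ ^+ m; nra.
Qed.

Lemma collision_ge i (s : R) : 0 <= s <= 1 ->
  'C(i, 2)%:R * s ^+ 2 - i%:R ^+ 3 * s ^+ 3 <= collision i s.
Proof.
case: i => [|m] s01; first by rewrite /collision /one_exception expr0 !mul0r addr0 !subrr expr0n /= mul0r oppr0.
rewrite collisionS bin2_natr; move/andP: (s01) => [s0 s1].
have hb := bernoulli_upper m s01.
have m0 : 0 <= m%:R :> R by [].
have h : (1 - s) ^+ m * (1 + m%:R * s) <=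
   (1 - m%:R * s + 'C(m, 2)%:R * s ^+ 2) * (1 + m%:R * s).
  by rewrite ler_wpM2r// addr_ge0// mulr_ge0.
have h2 : 'C(m, 2)%:R = m%:R * (m%:R - 1) / 2 :> R.
  by case: (m) => [|k]; rewrite ?mul0r// bin2_natr -natr1 addrK.
rewrite h2 in h; rewrite -natr1; move: h; set X := _ ^+ m * _; set x : R := m%:R in m0 *.
have : 0 <= x * s ^+ 3 by rewrite mulr_ge0// exprn_ge0.
have : 0 <= x ^+ 2 * s ^+ 3 by rewrite mulr_ge0// exprn_ge0.
have : 0 <= x ^+ 3 * s ^+ 3 by rewrite mulr_ge0// exprn_ge0.
have : 0 <= s ^+ 3 by rewrite exprn_ge0.
move=> a1 a2 a3 a4 h; rewrite lerBrDr; lra.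
Qed.

Lemma drift_ge i (s : R) : 0 <= s <= 1 ->
  i%:R * i.-1%:R * s - i%:R ^+ 3 * s ^+ 2 <= drift i s.
Proof.
case: i => [|m] s01; first by rewrite /drift !mul0r expr0n /= mul0r subrr.
rewrite /drift /=; move/andP: (s01) => [s0 s1].
have hb := bernoulli_upper m s01.
have h2 : 'C(m, 2)%:R <= m.+1%:R ^+ 2 :> R.
  have -> : 'C(m, 2)%:R = m%:R * (m%:R - 1) / 2 :> R.
    by case: (m) => [|k]; rewrite ?mul0r// bin2_natr -natr1 addrK.
  have : 0 <= m%:R :> R by [].
  rewrite -(natr1 m); set x : R := m%:R; move=> x0; have := sqr_ge0 x. lra.
have h3 : 'C(m, 2)%:R * s ^+ 2 <= m.+1%:R ^+ 2 * s ^+ 2.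
  by rewrite ler_wpM2r// sqr_ge0.
have -> : m.+1%:R * m%:R * s - m.+1%:R ^+ 3 * s ^+ 2 =
  m.+1%:R * (m%:R * s - m.+1%:R ^+ 2 * s ^+ 2) :> R by ring.
rewrite ler_wpM2l//; lra.
Qed.

Lemma convexity_gap i (s : R) : 0 <= s <= 1 -> 0 <= (1 - s) ^+ i - 1 + i%:R * s.
Proof. by move=> /(bernoulli_lower i); lra. Qed.

(** Degrees at least 2 make the generating function strictly convex, with a
    bound uniform in s; this forces the tail of H to decrease geometrically
    before its small-s asymptotics apply. *)
Lemma convexity_gap_ge i (s : R) : 0 <= s <= 1 -> (2 <= i)%N ->
  s ^+ 2 <= (1 - s) ^+ i - 1 + i%:R * s.
Proof.
move=> /andP[s0 s1]; case: i => [//|[//|i]] _.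
elim: i => [|i IH].
  by rewrite (_ : _ + _ = s ^+ 2)//; ring.
apply: le_trans IH _; rewrite -(natr1 i.+2) [in leRHS]exprS.
have : (1 - s) ^+ i.+2 <= 1 by rewrite exprn_ile1//; lra.
set X := _ ^+ _; rewrite -subr_ge0 => X1; have := mulr_ge0 s0 X1.
by set x : R := _%:R; lra.
Qed.

Context (p : nat -> R) (v : R) (p_ge0 : forall i, 0 <= p i) (v_gt0 : 0 < v).
Hypothesis mass_le : forall M, \sum_(i < M) p i <= 1.
Hypothesis mean_le : forall M, \sum_(i < M) p i * i%:R <= 1.
Hypothesis fact2_le : forall M, \sum_(i < M) p i * (i%:R * i.-1%:R) <= v.
Hypothesis mean_cvg : forall e, 0 < e ->
  exists K, forall M, (K <= M)%N -> 1 - e <= \sum_(i < M) p i * i%:R.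
Hypothesis fact2_cvg : forall e, 0 < e ->
  exists K, forall M, (K <= M)%N -> v - e <= \sum_(i < M) p i * (i%:R * i.-1%:R).
Context (B : nat) (B_ge2 : (2 <= B)%N) (pB_gt0 : 0 < p B).

Lemma ler_sum_widen (F : nat -> R) K M : (K <= M)%N -> (forall i, 0 <= F i) ->
  \sum_(i < K) F i <= \sum_(i < M) F i.
Proof.
move=> KM F0; rewrite -!sum_iota -(subnKC KM) iotaD big_cat /= lerDl.
by rewrite sumr_ge0.
Qed.

Lemma bin2_half_le M : \sum_(i < M) p i * 'C(i, 2)%:R <= v / 2.
Proof.
rewrite ler_pdivlMr// big_distrl /=; apply: le_trans (fact2_le M).
apply: ler_sum => -[[|i] ilt] _ /=; first by rewrite !(mul0r, mulr0).
by rewrite bin2_natr -[leLHS]mulrA divfK ?pnatr_eq0.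
Qed.

Lemma drift_sum_le M s : 0 <= s <= 1 -> \sum_(i < M) p i * drift i s <= v * s.
Proof.
move=> s01; have /andP[s0 _] := s01.
apply: (@le_trans _ _ ((\sum_(i < M) p i * (i%:R * i.-1%:R)) * s)).
  rewrite big_distrl /=; apply: ler_sum => i _; rewrite -mulrA ler_wpM2l//.
  exact: drift_le.
by rewrite ler_wpM2r.
Qed.

Lemma collision_sum_le M s : 0 <= s <= 1 -> \sum_(i < M) p i * collision i s <= v / 2 * s ^+ 2.
Proof.
move=> s01; apply: (@le_trans _ _ ((\sum_(i < M) p i * 'C(i, 2)%:R) * s ^+ 2)).
  rewrite big_distrl /=; apply: ler_sum => i _; rewrite -mulrA ler_wpM2l//.
  exact: collision_le.
by rewrite ler_wpM2r ?sqr_ge0// bin2_half_le.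
Qed.

(** Because the mean is at most 1, a sequence is a supersolution of the tail
    recursion as soon as the ratio of collision to drift is at most b'. *)
Lemma tail_step M b b' : 0 <= b' ->
  \sum_(i < M) p i * collision i b <= b' * \sum_(i < M) p i * drift i b ->
  \sum_(i < M) p i * (1 - one_exception i (1 - b) (b - b')) <= b'.
Proof.
move=> b'0 le.
have -> : \sum_(i < M) p i * (1 - one_exception i (1 - b) (b - b')) =
  \sum_(i < M) p i * collision i b + b' * (\sum_(i < M) p i * i%:R - \sum_(i < M) p i * drift i b).
  rewrite -sumrB big_distrr /= -big_split /=; apply: eq_bigr => i _.
  by rewrite one_exceptionE; ring.
have := ler_wpM2l b'0 (mean_le M); lra.
Qed.

Lemma large_letter_le : p B <= v.
Proof.
apply: le_trans (fact2_le B.+1); rewrite big_ord_recr /=.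
have : 1 <= B%:R * B.-1%:R :> R.
  by rewrite -natrM ler1n; case: (B) B_ge2 => [|[]].
have : 0 <= \sum_(i < B) p i * (i%:R * i.-1%:R).
  by rewrite sumr_ge0// => i _; rewrite !mulr_ge0.
have := pB_gt0; set X := \sum_(_ < _) _; set Y := _%:R * _; nra.
Qed.

(** A geometric decrease valid for all s: collision = s * drift - gap, the gap is
    at least p_B s^2 and the drift at most v s. *)
Lemma tail_step_contraction M b : (B < M)%N -> 0 <= b <= 1 ->
  \sum_(i < M) p i * collision i b <= (1 - p B / v) * b * \sum_(i < M) p i * drift i b.
Proof.
move=> BM b01; have /andP[b0 b1] := b01.
have e : b * (\sum_(i < M) p i * drift i b) - \sum_(i < M) p i * collision i b =
   \sum_(i < M) p i * ((1 - b) ^+ i - 1 + i%:R * b).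
  rewrite big_distrr /= -sumrB; apply: eq_bigr => i _.
  by rewrite -collision_drift; ring.
have : p B * b ^+ 2 <= \sum_(i < M) p i * ((1 - b) ^+ i - 1 + i%:R * b).
  rewrite (bigD1 (Ordinal BM)) //= -[leLHS]addr0 lerD//.
    by rewrite ler_wpM2l// convexity_gap_ge.
  by rewrite sumr_ge0// => i _; rewrite mulr_ge0// convexity_gap.
have := drift_sum_le M b01; move: e; set H := \sum_(i < M) p i * drift i b.
set P := \sum_(i < M) p i * collision i b => e hv gap.
have : p B / v * b * H <= p B / v * b * (v * b).
  by rewrite ler_wpM2l// !mulr_ge0// invr_ge0 ltW.
have -> : p B / v * b * (v * b) = p B * b ^+ 2 by field; rewrite gt_eqF.
lra.
Qed.

(** For small s the ratio of collision to drift is close to s/2: the collision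
    is at most v s^2 / 2, and the drift is at least (v - o(1)) s, already for
    finitely many degrees. *)
Lemma tail_step_fast rho : 1 / 2 < rho -> exists2 s0, 0 < s0 <= 1 & exists K,
  forall M b, (K <= M)%N -> 0 <= b <= s0 ->
  \sum_(i < M) p i * collision i b <= rho * b * \sum_(i < M) p i * drift i b.
Proof.
move=> rho2; have rho0 : 0 < rho by lra.
pose e := v * (1 - (2 * rho)^-1) / 2.
have e0 : 0 < e.
  rewrite divr_gt0// mulr_gt0// subr_gt0 invf_lt1 ?mulr_gt0//; lra.
have [K hK] := fact2_cvg e0.
pose c := \sum_(i < K) p i * i%:R ^+ 3.
have c0 : 0 <= c by rewrite sumr_ge0// => i _; rewrite mulr_ge0// exprn_ge0.
have c1 : 0 < c + 1 by lra.
exists (Num.min 1 (e / (c + 1))).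
  by rewrite lt_min ltr01 divr_gt0//= ge_min lexx.
exists K => M b KM /andP[b0]; rewrite le_min => /andP[b1 be].
have b01 : 0 <= b <= 1 by rewrite b0.
apply: le_trans (collision_sum_le M b01) _.
have h1 : \sum_(i < K) p i * drift i b <= \sum_(i < M) p i * drift i b.
  by apply: (ler_sum_widen (F := fun i => p i * drift i b)) => // i; rewrite mulr_ge0// drift_ge0.
have h2 : (v - e) * b - c * b ^+ 2 <= \sum_(i < K) p i * drift i b.
  apply: (@le_trans _ _ ((\sum_(i < K) p i * (i%:R * i.-1%:R)) * b - c * b ^+ 2)).
    by rewrite lerD2r ler_wpM2r// hK.
  rewrite /c !big_distrl -sumrB /=; apply: ler_sum => i _.
  by have := ler_wpM2l (p_ge0 i) (drift_ge i b01); rewrite mulrBr !mulrA.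
have h3 : c * b <= e.
  rewrite ler_pdivlMr// in be; apply: le_trans be; rewrite mulrC ler_wpM2l//; lra.
have h4 : rho * (v - 2 * e) = v / 2 by rewrite /e; field; rewrite gt_eqF.
have h5 : (v - 2 * e) * b <= \sum_(i < M) p i * drift i b.
  have := ler_wpM2r b0 h3; lra.
rewrite -h4; have := ler_wpM2l (mulr_ge0 (ltW rho0) b0) h5; lra.
Qed.

(** The supersolution decreases with the slow uniform ratio until it is below
    the threshold of [tail_step_fast], then with ratio rho. *)
Lemma horton_tail rho : 1 / 2 < rho < 1 -> exists2 C, 0 < C & exists K,
  forall M k N, (K <= M)%N ->
    \sum_(t <- trees M N | (k <= horton_strahler t)%N) wtree p t <= C * rho ^+ k.
Proof.
move=> /andP[rho2 rho1]; have rho0 : 0 < rho by lra.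
have [s0 /andP[s00 s01] [K hK]] := tail_step_fast rho2.
pose th := 1 - p B / v.
have th0 : 0 <= th by rewrite subr_ge0 ler_pdivrMr// mul1r large_letter_le.
have th1 : th < 1 by rewrite ltrBlDr ltrDl divr_gt0.
have [k0 hk0] : exists k0, th ^+ k0 <= s0.
  have : (fun n => th ^+ n) @ \oo --> (0 : R) by apply: cvg_expr; rewrite ger0_norm.
  move=> /cvgr0_norm_lt/(_ _ s00)[k0 _ /(_ k0 (leqnn k0))].
  by move=> /ltW/(le_trans (ler_norm _)); exists k0.
(* k0 levels at the slow ratio th bring the sequence below s0. *)
pose b k := th ^+ minn k k0 * rho ^+ (k - k0).
have bE1 k : (k <= k0)%N -> b k = th ^+ k.
  by move=> kk; rewrite /b (minn_idPl kk) (eqP kk) expr0 mulr1.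
have b0 k : 0 <= b k by rewrite mulr_ge0// exprn_ge0// ltW.
have bS k : b k.+1 = (if (k < k0)%N then th else rho) * b k.
  rewrite /b; case: ltnP => kk.
    rewrite (minn_idPl kk) (eqP kk : (k.+1 - k0 = 0)%N) (eqP (ltnW kk) : (k - k0 = 0)%N).
    by rewrite exprS mulrA.
  rewrite (minn_idPr (leqW kk)).
  by rewrite subSn// exprS; ring.
have bdec k : 0 <= b k.+1 <= b k.
  rewrite b0 bS ler_piMl//; case: ifP => _; exact: ltW.
have b1 k : b k <= 1.
  elim: k => [|k IH]; first by rewrite bE1// expr0.
  by have /andP[_ h] := bdec k; exact: le_trans h IH.
exists ((rho ^+ k0)^-1); first by rewrite invr_gt0 exprn_gt0.
exists (maxn K B.+1) => M k N; rewrite geq_max => /andP[KM BM].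
apply: (@le_trans _ _ (b k)); last first.
  rewrite /b; apply: (@le_trans _ _ (rho ^+ (k - k0))).
    by rewrite ler_piMl ?exprn_ge0 ?exprn_ile1// ltW.
  rewrite mulrC ler_pdivlMr ?exprn_gt0// -exprD ler_wiXn2l ?ltW//.
  by rewrite addnC -leq_subLR.
apply: horton_ge_supersolution => //; first by rewrite bE1// expr0.
move=> j; apply: tail_step => //; rewrite bS; case: ltnP => jk.
  by apply: tail_step_contraction; rewrite // b0 b1.
apply: hK => //; rewrite b0 /=; apply: le_trans hk0.
by rewrite /b (minn_idPr jk) ler_piMr ?exprn_ge0 ?exprn_ile1 ?(ltW rho0) ?(ltW rho1).
Qed.

(** The sequence 1 - s0 r^k is a supersolution for the generating functions at
    z as long as z - 1 is small compared to r^(2k): a ratio r below 1/2 leaves a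
    slack of order r^(2k) in each step, which absorbs z - 1. *)
Lemma horton_small r : 0 < r < 1 / 2 -> exists2 c, 0 < c &
  forall z M K N, 1 <= z -> z - 1 <= c * (r ^+ K) ^+ 2 ->
    \sum_(t <- trees M N | (horton_strahler t < K)%N) wtree (fun i => z * p i) t <= 1.
Proof.
move=> /andP[r0 r2].
(* The slack v (1/2 - r) s^2 is shared between the truncation of the second
   moment, the cubic error, the truncation of the mean and z - 1. *)
pose ka := v * (1 / 2 - r) / 4.
have ka0 : 0 < ka by rewrite divr_gt0// mulr_gt0//; lra.
have [K1 hK1] := fact2_cvg ka0.
pose c := \sum_(i < K1) p i * i%:R ^+ 3.
have c0 : 0 <= c by rewrite sumr_ge0// => i _; rewrite mulr_ge0// exprn_ge0.
have c1 : 0 < c + 1 by lra.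
pose s0 := Num.min 1 (ka / (c + 1)).
have s00 : 0 < s0 by rewrite lt_min ltr01 divr_gt0.
have s01 : s0 <= 1 by rewrite ge_min lexx.
have s0c : c * s0 <= ka.
  apply: (@le_trans _ _ (c * (ka / (c + 1)))); first by rewrite ler_wpM2l// ge_min lexx orbT.
  rewrite mulrA ler_pdivrMr//; have := mulr_ge0 c0 (ltW ka0); lra.
exists (ka * s0 ^+ 2) => [|z M K N z1 hz]; first by rewrite mulr_gt0// exprn_gt0.
have z0 : 0 <= z by lra.
pose a k := s0 * r ^+ k.
have a0 k : 0 < a k by rewrite mulr_gt0// exprn_gt0.
have as0 k : a k <= s0 by rewrite /a ler_piMr ?exprn_ile1//; lra.
have aS k : a k.+1 = r * a k by rewrite /a exprS mulrCA.
have adec k : a k.+1 <= a k by rewrite aS ler_piMl//; [exact: ltW|lra].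
apply: (@le_trans _ _ (1 - a K)); last by have := a0 K; lra.
apply: (@horton_lt_supersolution _ _ _ _ (fun k => 1 - a k)) => [i|||k kK].
- by rewrite mulr_ge0.
- have := as0 0; lra.
- by move=> k _; have := adec k; lra.
have e0 : 0 < ka * a k by rewrite mulr_gt0.
have [K2 hK2] := mean_cvg e0.
(* All terms are nonnegative, so more degrees may be included in the sum. *)
pose M' := maxn M (maxn K1 K2).
have MM' : (M <= M')%N by rewrite leq_maxl.
have KM1 : (K1 <= M')%N by rewrite /M' !leq_max leqnn orbT.
have KM2 : (K2 <= M')%N by rewrite /M' !leq_max leqnn !orbT.
have ak0 := a0 k; have aks := as0 k.
have ak01 : 0 <= a k <= 1 by rewrite ltW//=; lra.
have aka' := adec k.
have -> : 1 - a k.+1 - (1 - a k) = a k - a k.+1 by ring.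
apply: (@le_trans _ _ (\sum_(i < M') z * p i * one_exception i (1 - a k) (a k - a k.+1))).
  apply: (ler_sum_widen (F := fun i => z * p i * one_exception i (1 - a k) (a k - a k.+1))) => // i.
  by rewrite !mulr_ge0// addr_ge0 ?mulr_ge0 ?exprn_ge0 ?subr_ge0//; lra.
have -> : \sum_(i < M') z * p i * one_exception i (1 - a k) (a k - a k.+1) =
   z * (\sum_(i < M') p i - \sum_(i < M') p i * collision i (a k)
     - a k.+1 * (\sum_(i < M') p i * i%:R) + a k.+1 * \sum_(i < M') p i * drift i (a k)).
  rewrite !big_distrr /= -!sumrB -big_split /= big_distrr /=; apply: eq_bigr => i _.
  by rewrite one_exceptionE; ring.
have h1 := mass_le M'.
have h2 := hK2 M' KM2.
have h3 := drift_sum_le M' ak01.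
have h4 : \sum_(i < K1) p i * collision i (a k) <= \sum_(i < M') p i * collision i (a k).
  by apply: (ler_sum_widen (F := fun i => p i * collision i (a k))) => // i; rewrite mulr_ge0// collision_ge0.
have h5 : (v / 2 - ka) * a k ^+ 2 - c * a k ^+ 3 <= \sum_(i < K1) p i * collision i (a k).
  apply: (@le_trans _ _ ((\sum_(i < K1) p i * 'C(i, 2)%:R) * a k ^+ 2 - c * a k ^+ 3)).
    rewrite lerD2r ler_wpM2r ?sqr_ge0//.
    have -> : \sum_(i < K1) p i * 'C(i, 2)%:R = (\sum_(i < K1) p i * (i%:R * i.-1%:R)) / 2.
      rewrite big_distrl /=; apply: eq_bigr => -[[|i] ilt] _ /=; first by rewrite !mul0r mulr0 mul0r.
      by rewrite bin2_natr -[RHS]mulrA.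
    by rewrite ler_pdivlMr//; have := hK1 K1 (leqnn _); lra.
  rewrite /c !big_distrl -sumrB /=; apply: ler_sum => i _.
  by have := ler_wpM2l (p_ge0 i) (collision_ge i ak01); rewrite mulrBr !mulrA.
have h6 : c * a k ^+ 3 <= ka * a k ^+ 2.
  rewrite (exprS _ 2) mulrA ler_wpM2r ?sqr_ge0//.
  by apply: le_trans s0c; rewrite ler_wpM2l.
have ak1 : 0 < a k.+1 by exact: a0.
have h7 : a k.+1 * (1 - ka * a k) <= a k.+1 * \sum_(i < M') p i * i%:R.
  by rewrite ler_wpM2l// ltW.
have h8 : a k.+1 * (\sum_(i < M') p i * drift i (a k)) <= r * v * a k ^+ 2.
  apply: (@le_trans _ _ (a k.+1 * (v * a k))); first by rewrite ler_wpM2l// ltW.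
  rewrite le_eqVlt; apply/orP; left; apply/eqP; rewrite aS; ring.
have h9 : a k.+1 * (ka * a k) <= ka * a k ^+ 2.
  rewrite mulrCA ler_wpM2l// ?(ltW ka0)// expr2 ler_wpM2r// ltW//.
have e4 : v / 2 - r * v = 4 * ka by rewrite /ka; field.
have h10 : z - 1 <= ka * a k ^+ 2.
  apply: le_trans hz _.
  have -> : ka * a k ^+ 2 = ka * s0 ^+ 2 * (r ^+ k) ^+ 2 by rewrite /a; ring.
  apply: ler_wpM2l; first by rewrite mulr_ge0 ?sqr_ge0// ltW.
  have rK : r ^+ K <= r ^+ k by apply: ler_wiXn2l; rewrite ?(ltW r0) ?(ltnW kK)//; lra.
  by rewrite lerXn2r ?nnegrE ?exprn_ge0 ?(ltW r0).
set S := (X in z * X).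
have hS : S <= 1 - a k.+1 - ka * a k ^+ 2.
  rewrite /S; have : v / 2 * a k ^+ 2 - r * v * a k ^+ 2 = 4 * ka * a k ^+ 2 by rewrite -e4; ring.
  lra.
have := ler_wpM2l z0 hS.
have q0 : 0 <= ka * a k ^+ 2 by rewrite mulr_ge0 ?sqr_ge0// ltW.
have z10 : 0 <= z - 1 by lra.
have := mulr_ge0 z10 (ltW ak1); have := mulr_ge0 z10 q0.
lra.
Qed.

End OneVariable.

(** * Central binomial coefficients *)

Lemma central_binS h : (h.+1 * 'C(h.+1.*2, h.+1) = h.*2.+1.*2 * 'C(h.*2, h))%N.
Proof.
have e1 := mul_bin_diag h.+1.*2 h; have e2 := mul_bin_diag h.*2.+1 h.
rewrite doubleS /= in e1 *; rewrite /= in e2.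
have e3 : 'C(h.*2.+1, h) = 'C(h.*2.+1, h.+1).
  by rewrite -[in RHS]bin_sub; [congr 'C(_, _)|]; lia.
apply/eqP; rewrite -(@eqn_pmul2l h.+1)//; apply/eqP; rewrite -e1 e3.
transitivity (h.*2.+2 * (h.+1 * 'C(h.*2.+1, h.+1)))%N; first by rewrite mulnCA.
by rewrite -e2 -!mul2n; nia.
Qed.

Lemma central_bin_le h : ('C(h.*2, h) ^ 2 * h.*2.+1 <= 16 ^ h)%N.
Proof.
elim: h => // h IH; have := central_binS h.
set C' := 'C(_, _); set C := 'C(_, _) in IH * => e.
have : (h.+1 ^ 2 * (C' ^ 2 * h.+1.*2.+1) <= h.+1 ^ 2 * 16 ^ h.+1)%N.
  rewrite mulnA -expnMn e expnMn (expnS 16).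
  have : (h.*2.+1.*2 ^ 2 * C ^ 2 * h.+1.*2.+1 <= 4 * (h.*2.+1 * h.+1.*2.+1) * 16 ^ h)%N.
    apply: (@leq_trans (4 * (h.*2.+1 * h.+1.*2.+1) * (C ^ 2 * h.*2.+1))).
      by rewrite -!mul2n -!mulnn; nia.
    by rewrite leq_mul2l IH orbT.
  move=> /leq_trans; apply; rewrite [leqRHS]mulnA leq_mul2r; apply/orP; right.
  by rewrite -!mul2n -!mulnn; nia.
by rewrite leq_mul2l expn_eq0.
Qed.

Lemma central_bin_ge h : (0 < h)%N -> (16 ^ h <= 'C(h.*2, h) ^ 2 * (4 * h))%N.
Proof.
case: h => // h _; elim: h => // h IH; have := central_binS h.+1.
set C' := 'C(_, _); set C := 'C(_, _) in IH * => e.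
have : (h.+2 ^ 2 * h.+1 * 16 ^ h.+2 <= h.+2 ^ 2 * h.+1 * (C' ^ 2 * (4 * h.+2)))%N.
  have -> : (h.+2 ^ 2 * h.+1 * (C' ^ 2 * (4 * h.+2)) =
     (h.+2 * C') ^ 2 * (h.+1 * 4 * h.+2))%N by rewrite expnMn; lia.
  rewrite e (expnS 16).
  apply: (@leq_trans (h.+2 ^ 2 * h.+1 * (16 * (C ^ 2 * (4 * h.+1)))))%N.
    by rewrite leq_mul2l leq_mul2l IH !orbT.
  rewrite expnMn; move: (C ^ 2)%N => D.
  apply: (@leq_trans (D * (h.+2 ^ 2 * h.+1 * (16 * (4 * h.+1)))))%N; first lia.
  apply: (@leq_trans (D * (h.+1.*2.+1.*2 ^ 2 * (h.+1 * 4 * h.+2))))%N; last lia.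
  by rewrite leq_mul2l -!mul2n -!mulnn; apply/orP; right; nia.
by rewrite leq_mul2l muln_eq0 expn_eq0.
Qed.

Lemma bin_le_central h j : ('C(h.*2, j) <= 'C(h.*2, h))%N.
Proof.
have inc i : (i < h)%N -> ('C(h.*2, i) <= 'C(h.*2, i.+1))%N.
  move=> ih; have := mul_bin_left h.*2 i.
  rewrite -(@leq_pmul2l i.+1)// => ->; rewrite leq_mul2r; apply/orP; right; lia.
have H i : (i <= h)%N -> ('C(h.*2, h - i) <= 'C(h.*2, h))%N.
  elim: i => [|i IH] ih; first by rewrite subn0.
  apply: leq_trans (IH (ltnW ih)); have := inc (h - i.+1)%N.
  by rewrite subnSK//; apply; lia.
case: (leqP j h) => jh; first by have := H (h - j)%N; rewrite subKn//; apply; lia.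
case: (leqP j h.*2) => j2; last by rewrite bin_small.
rewrite -bin_sub//; have := H (j - h)%N; rewrite (_ : h - (j - h) = h.*2 - j)%N; last lia.
by apply; lia.
Qed.

Section Binomial.
Context {R : realType}.

Lemma one_minus_ge_exp (x : R) : 0 <= x <= 1 / 2 -> expR (- (2 * x)) <= 1 - x.
Proof.
move=> /andP[x0 x1]; rewrite expRN -[leRHS]invrK lef_pV2 ?posrE ?expR_gt0//; last first.
  by rewrite invr_gt0; lra.
apply: le_trans (expR_ge1Dx _); rewrite -[leLHS]mul1r ler_pdivrMr; last lra.
have : 0 <= x * (1 / 2 - x) by rewrite mulr_ge0//; lra.
lra.
Qed.

(** Each of the d ratios of consecutive coefficients between the center and
    distance d is at least 1 - 2d/h, and (1 - 2d/h)^d stays away from 0 for d of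
    order sqrt h. *)
Lemma bin_off_center (L : R) : 0 < L -> exists2 c, 0 < c & exists h0,
  forall h j d, (h0 <= h)%N -> d%:R ^+ 2 <= L * h%:R ->
    (j = h + d \/ j + d = h)%N ->
    c / Num.sqrt h%:R <= 'C(h.*2, j)%:R / 4 ^+ h :> R.
Proof.
move=> L0; exists (expR (- (4 * L)) / 2); first by rewrite divr_gt0// expR_gt0.
exists (Num.bound (16 * L)).+1 => h j d hh hd jd.
have h0 : (0 < h)%N by case: (h) hh.
have hR : 0 < h%:R :> R by rewrite ltr0n.
have hL : 16 * L <= h%:R.
  apply: (@le_trans _ _ (Num.bound (16 * L))%:R); last by rewrite ler_nat ltnW.
  by apply/ltW/archi_boundP; rewrite mulr_ge0// ltW.
have d0 : 0 <= d%:R :> R by [].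
have dh4 : d%:R <= h%:R / 4 :> R.
  rewrite -(@ler_pXn2r _ 2) ?nnegrE ?divr_ge0//.
  apply: le_trans hd _.
  have -> : (h%:R / 4) ^+ 2 = h%:R * (h%:R / 16) :> R by field.
  by rewrite mulrC ler_wpM2l//; lra.
have dh : (d <= h)%N.
  by rewrite -(ler_nat R); lra.
have -> : 'C(h.*2, j) = 'C(h.*2, h + d).
  case: jd => [->//|e]; rewrite -[RHS]bin_sub; last lia.
  congr 'C(_, _); lia.
have step i : (i < d)%N -> (1 - 2 * d%:R / h%:R) * 'C(h.*2, h + i)%:R <= 'C(h.*2, h + i.+1)%:R :> R.
  move=> id; have e := mul_bin_left h.*2 (h + i).
  rewrite -addnS in e.
  have hp : 0 < (h + i.+1)%:R :> R by rewrite ltr0n addnS.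
  rewrite -(ler_pM2l hp) -[leRHS]natrM addnS -addnS e natrM mulrA ler_wpM2r//.
  rewrite mulrBr mulr1 lerBlDr -lerBlDl natrB; last lia.
  rewrite -mul2n natrM.
  apply: (@le_trans _ _ (2 * d%:R)).
    have : i.+1%:R <= d%:R :> R by rewrite ler_nat.
    rewrite !natrD -natr1; lra.
  have e2 : h%:R * (2 * d%:R / h%:R) = 2 * d%:R :> R by field; rewrite gt_eqF.
  rewrite -[leLHS]e2 ler_wpM2r ?divr_ge0 ?mulr_ge0 ?(ltW hR)// ler_nat; lia.
set q := 1 - 2 * d%:R / h%:R in step.
have x1 : (0 : R) <= 2 * d%:R / h%:R by rewrite divr_ge0 ?mulr_ge0 ?(ltW hR).
have x2 : 2 * d%:R / h%:R <= 1 / 2 :> R by rewrite ler_pdivrMr//; lra.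
have q0 : 0 <= q by rewrite /q; lra.
have H i : (i <= d)%N -> q ^+ i * 'C(h.*2, h)%:R <= 'C(h.*2, h + i)%:R :> R.
  elim: i => [|i IH] id; first by rewrite expr0 mul1r addn0.
  apply: le_trans (step _ id); rewrite exprS -mulrA ler_wpM2l//; exact/IH/ltnW.
have qd : expR (- (4 * L)) <= q ^+ d.
  apply: (@le_trans _ _ (expR (- (2 * (2 * d%:R / h%:R))) ^+ d)); last first.
    by rewrite lerXn2r ?nnegrE ?expR_ge0// one_minus_ge_exp// x1.
  rewrite -expRM_natl ler_expR mulrN lerN2.
  have -> : d%:R * (2 * (2 * d%:R / h%:R)) = 4 * (d%:R ^+ 2 / h%:R) :> R by ring.
  by rewrite ler_wpM2l// ler_pdivrMr.
rewrite ler_pdivlMr ?exprn_gt0//; apply: le_trans (H d (leqnn _)).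
rewrite -mulrA -mulrA ler_pM ?expR_ge0 ?mulr_ge0 ?invr_ge0 ?sqrtr_ge0 ?exprn_ge0//.
have hc : 4 ^+ h <= 'C(h.*2, h)%:R * (2 * Num.sqrt h%:R) :> R.
  rewrite -(@ler_pXn2r _ 2) ?nnegrE ?mulr_ge0 ?sqrtr_ge0 ?exprn_ge0//.
  rewrite !exprMn sqr_sqrtr ?(ltW hR)// -exprM mulnC exprM.
  have -> : 4 ^+ 2 = 16 :> R by ring.
  have -> : 2 ^+ 2 = 4 :> R by ring.
  have := central_bin_ge h0; rewrite -(ler_nat R) !natrM !natrX; apply: le_trans.
  by rewrite lexx.
have s0 : 0 < Num.sqrt h%:R :> R by rewrite sqrtr_gt0.
rewrite mulrA -invfM mulrC ler_pdivrMr ?mulr_gt0//.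
Qed.

Lemma bin_le_sqrt m j : (0 < m)%N -> 'C(m, j)%:R / 2 ^+ m <= 1 / Num.sqrt m%:R :> R.
Proof.
move=> m0.
have even h k : 'C(h.*2, k)%:R / 2 ^+ h.*2 <= 1 / Num.sqrt h.*2.+1%:R :> R.
  have s0 : 0 < Num.sqrt h.*2.+1%:R :> R by rewrite sqrtr_gt0.
  rewrite ler_pdivrMr ?exprn_gt0// mulrAC mul1r ler_pdivlMr//.
  rewrite -(@ler_pXn2r _ 2) ?nnegrE ?mulr_ge0 ?sqrtr_ge0 ?exprn_ge0//.
  rewrite exprMn sqr_sqrtr//.
  have -> : (2 ^+ h.*2) ^+ 2 = 16 ^+ h :> R.
    by rewrite -exprM -mul2n mulnC mulnA exprM; congr (_ ^+ _); ring.
  apply: (@le_trans _ _ ('C(h.*2, h)%:R ^+ 2 * h.*2.+1%:R)).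
    by rewrite ler_wpM2r// lerXn2r ?nnegrE// ler_nat bin_le_central.
  by have := central_bin_le h; rewrite -(ler_nat R) natrM !natrX.
have [h [b e]] : exists h b, m = (nat_of_bool b + h.*2)%N.
  by exists m./2, (odd m); rewrite odd_double_half.
apply: (@le_trans _ _ (1 / Num.sqrt h.*2.+1%:R)); last first.
  rewrite !mul1r lef_pV2 ?posrE ?sqrtr_gt0 ?ltr0n// ler_wsqrtr// ler_nat e.
  by case: (b); rewrite ?add1n// add0n.
case: b e => e; rewrite {m0}e ?add0n ?even// add1n.
rewrite exprS invfM mulrA; case: j => [|j].
  have := even h 0%N; rewrite !bin0; set X := 1 / _; set Y := (2 ^+ _)^-1.
  have : 0 <= Y by rewrite invr_ge0 exprn_ge0.
  lra.
rewrite binS natrD.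
have := even h j; have := even h j.+1; set X := 1 / _; set Y := (2 ^+ _)^-1; lra.
Qed.

End Binomial.

(** * Second moments of weighted sequences *)

Section Chebyshev.
Context {R : realFieldType} {T : Type} (s : seq T) (f : T -> R).
Context (f_ge0 : forall c, 0 <= f c) (x : T -> R).

Let A := \sum_(c <- s) f c.
Let m1 := \sum_(c <- s) f c * x c.
Let m2 := \sum_(c <- s) f c * x c ^+ 2.

Definition xsum (l : seq T) : R := \sum_(c <- l) x c.

Definition moment n (k : nat) : R :=
  \sum_(l <- seqs s n) (\prod_(c <- l) f c) * xsum l ^+ k.

Lemma moment0 n : moment n 0 = A ^+ n.
Proof.
rewrite -(seq_sumT s f) /seq_sum; apply: eq_bigr => l _; by rewrite expr0 mulr1.
Qed.

Lemma momentS1 n : moment n.+1 1 = m1 * A ^+ n + A * moment n 1.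
Proof.
rewrite -moment0 /moment (big_seqsS _ _ xpredT) !big_distrl -big_split /=.
apply: eq_bigr => c _; rewrite !big_distrr -big_split /=; apply: eq_bigr => l _.
by rewrite big_cons /xsum big_cons !expr1 expr0; ring.
Qed.

Lemma momentS2 n : moment n.+1 2 = m2 * A ^+ n + 2 * m1 * moment n 1 + A * moment n 2.
Proof.
rewrite -moment0 /moment (big_seqsS _ _ xpredT) (big_distrr 2) !big_distrl -!big_split /=.
apply: eq_bigr => c _; rewrite !big_distrr -!big_split /=; apply: eq_bigr => l _.
by rewrite big_cons /xsum big_cons !expr1 expr0; ring.
Qed.

(** The letters need not be centered exactly: a bias b of order 1/n in each
    letter, due to truncation, only adds a bounded term. *)
Lemma moment2_le n (b D : R) : A <= 1 -> `|m1| <= b -> m2 <= D ->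
  moment n 2 <= n%:R * D + (n%:R * b) ^+ 2.
Proof.
move=> A1 mb mD; have A0 : 0 <= A by rewrite sumr_ge0.
have b0 : 0 <= b by apply: le_trans mb.
have An k : 0 <= A ^+ k <= 1 by rewrite exprn_ge0// exprn_ile1.
have m20 : 0 <= m2 by rewrite sumr_ge0// => c _; rewrite mulr_ge0// sqr_ge0.
have H1 k : `|moment k 1| <= k%:R * b.
  elim: k => [|k IH].
    rewrite /moment /= big_seq1 /xsum !big_nil expr1 mulr0 normr0 mul0r//.
  rewrite momentS1 -natr1 mulrDl mul1r addrC; apply: le_trans (ler_normD _ _) _.
  have /andP[a0 a1] := An k.
  rewrite lerD// normrM.
    by rewrite (ger0_norm A0); apply: le_trans IH; rewrite ler_piMl.
  by rewrite (ger0_norm a0); apply: le_trans mb; rewrite ler_piMr.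
elim: n => [|n IH].
  by rewrite /moment /= big_seq1 /xsum !big_nil expr0n /= mulr0 !mul0r expr0n /= addr0.
rewrite momentS2; have /andP[a0 a1] := An n.
have h1 : m2 * A ^+ n <= D by apply: le_trans mD; rewrite ler_piMr.
have h2 : 2 * m1 * moment n 1 <= 2 * b * (n%:R * b).
  rewrite -!mulrA ler_wpM2l//; apply: le_trans (ler_norm _) _.
  by rewrite normrM ler_pM.
have M0 : 0 <= moment n 2.
  by apply: sumr_ge0 => l _; rewrite mulr_ge0 ?sqr_ge0// prodr_ge0.
have h3 : A * moment n 2 <= moment n 2 by rewrite ler_piMl.
have : 0 <= b ^+ 2 by rewrite sqr_ge0.
rewrite -natr1; lra.
Qed.

Lemma chebyshev_seq_sum n (b D L : R) : A <= 1 -> `|m1| <= b -> m2 <= D -> 0 <= L ->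
  L ^+ 2 * seq_sum s f n (fun l => L < `|xsum l|) <= n%:R * D + (n%:R * b) ^+ 2.
Proof.
move=> A1 mb mD L0; apply: le_trans (moment2_le n A1 mb mD).
rewrite /seq_sum /moment big_distrr /= big_mkcond; apply: ler_sum => l _.
have p0 : 0 <= \prod_(c <- l) f c by rewrite prodr_ge0.
case: ifP => [Lx|_]; last by rewrite mulr_ge0// sqr_ge0.
rewrite mulrC ler_wpM2l// -[leRHS]real_normK ?num_real//.
by rewrite lerXn2r ?nnegrE// ltW.
Qed.

End Chebyshev.

(** * The Bernoulli part of a lattice walk *)

Section LatticeWalk.
Context {R : realType} (p : nat -> R) (p_ge0 : forall i, 0 <= p i).

(** Positions are integers here, so that shifting by a step needs no side
    condition. *)
Definition zwalk K n (x : int) : R :=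
  \sum_(w <- seqs (iota 0 K) n | (sumn w)%:Z == x) wword p w.

Lemma walk_zwalk K n x : walk p K n x = zwalk K n x%:Z.
Proof. by rewrite /walk /words /zwalk big_filter. Qed.

Lemma zwalk0 K x : zwalk K 0 x = (x == 0)%:R.
Proof.
rewrite /zwalk /= big_mkcond big_seq1 /wword big_nil eq_sym.
by case: (x == 0).
Qed.

Lemma zwalkS K n x : zwalk K n.+1 x = \sum_(i < K) p i * zwalk K n (x - i%:Z).
Proof.
rewrite /zwalk (big_seqsS _ _ (fun w => (sumn w)%:Z == x)).
rewrite (sum_iota K (fun i => \sum_(l <- seqs (iota 0 K) n | (sumn (i :: l))%:Z == x) wword p (i :: l))).
apply: eq_bigr => i _; rewrite big_distrr /=; apply: eq_big => [l|l _].
  by rewrite /= PoszD [RHS]eq_sym subr_eq eq_sym addrC.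
by rewrite /wword big_cons.
Qed.

Lemma zwalk_cat K m n x : zwalk K (m + n) x =
  \sum_(w <- seqs (iota 0 K) m) wword p w * zwalk K n (x - (sumn w)%:Z).
Proof.
elim: m x => [|m IH] x; first by rewrite /= big_seq1 /wword big_nil mul1r subr0.
rewrite addSn zwalkS (big_seqsS _ _ xpredT) (sum_iota K (fun i => \sum_(l <- seqs (iota 0 K) m)
   wword p (i :: l) * zwalk K n (x - (sumn (i :: l))%:Z))).
apply: eq_bigr => i _; rewrite IH big_distrr; apply: eq_bigr => w _ /=.
by rewrite /wword big_cons mulrA PoszD opprD addrA.
Qed.

Context (B : nat) (B_ge2 : (2 <= B)%N).

(** The law of B times a binomial (m, 1/2) variable, with Pascal's rule as
    definition. *)
Fixpoint half_binomial (m : nat) (y : int) : R :=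
  if m is m'.+1 then (half_binomial m' y + half_binomial m' (y - B%:Z)) / 2 else (y == 0)%:R.

Lemma half_binomial_notin m y : (forall j : nat, y != (B * j)%:Z) -> half_binomial m y = 0.
Proof.
elim: m y => [|m IH] y /= ny; first by have := ny 0%N; rewrite muln0 => /negbTE ->.
rewrite !IH ?addr0 ?mul0r// => j; have := ny j.+1.
by apply: contra => /eqP e; apply/eqP; rewrite mulnS PoszD -e subrKC.
Qed.

Lemma half_binomial_mul m j : half_binomial m (B * j)%:Z = 'C(m, j)%:R / 2 ^+ m.
Proof.
have B0 : (0 < B)%N by apply: leq_trans B_ge2.
elim: m j => [|m IH] j /=.
  rewrite expr0 divr1 bin0n; congr (nat_of_bool _)%:R.
  by rewrite eqz_nat muln_eq0 gtn_eqF.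
rewrite IH; case: j => [|j].
  rewrite half_binomial_notin => [|j]; last by rewrite muln0; lia.
  by rewrite !bin0 addr0 exprS invfM; ring.
rewrite (_ : (B * j.+1)%:Z - B%:Z = (B * j)%:Z); last by rewrite mulnS; lia.
by rewrite IH binS natrD exprS invfM; ring.
Qed.

Lemma half_binomial_ge0 m y : 0 <= half_binomial m y.
Proof. by elim: m y => [|m IH] y //=; rewrite divr_ge0// addr_ge0. Qed.

Lemma half_binomial_le m y : (0 < m)%N -> half_binomial m y <= 1 / Num.sqrt m%:R.
Proof.
move=> m0; case: (pselect (exists j : nat, y = (B * j)%:Z)) => [[j ->]|ny].
  by rewrite half_binomial_mul; exact: bin_le_sqrt.
rewrite half_binomial_notin ?divr_ge0 ?sqrtr_ge0// => j.
by apply/eqP => e; apply: ny; exists j.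
Qed.

Lemma half_binomial_le1 m y : half_binomial m y <= 1.
Proof.
elim: m y => [|m IH] y /=; first by case: (y == 0).
by have := IH y; have := IH (y - B%:Z); lra.
Qed.

Context (gam : R) (gam_gt0 : 0 < gam) (gam0 : gam <= p 0) (gamB : gam <= p B).

(** What remains of the step law once a fair choice between 0 and B has been
    taken out with total weight 2 gam. *)
Definition residual (i : nat) : R := p i - (if (i == 0%N) || (i == B) then gam else 0).

Lemma residual_ge0 i : 0 <= residual i.
Proof.
rewrite /residual subr_ge0; case: ifP => // /orP[]/eqP -> //.
Qed.

Lemma residual_le i : residual i <= p i.
Proof. by rewrite /residual lerBlDr lerDl; case: ifP => // _; exact: ltW. Qed.

(** A step is either an ordinary letter or the mark None, which stands for a
    fair choice between 0 and B. *)
Definition letters K : seq (option nat) := None :: map Some (iota 0 K).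
Definition letter_weight (c : option nat) : R := if c is Some i then residual i else 2 * gam.
Definition visible_sum (l : seq (option nat)) : nat := sumn (map (odflt 0%N) l).
Definition marks (l : seq (option nat)) : nat := count (pred1 None) l.

Lemma letter_weight_ge0 c : 0 <= letter_weight c.
Proof. by case: c => [i|] /=; [exact: residual_ge0|rewrite mulr_ge0// ltW]. Qed.

Lemma sum_letters K (F : option nat -> R) :
  \sum_(c <- letters K) F c = F None + \sum_(i < K) F (Some (i : nat)).
Proof. by rewrite /letters big_cons big_map (sum_iota K (fun i => F (Some i))). Qed.

Lemma sum_residual K (G : nat -> R) : (B < K)%N ->
  \sum_(i < K) p i * G i = gam * (G 0 + G B) + \sum_(i < K) residual i * G i.
Proof.
move=> BK; have K0 : (0 < K)%N by apply: leq_trans BK.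
have B0 : (0 < B)%N by apply: leq_trans B_ge2.
have e : \sum_(i < K) (if ((i : nat) == 0%N) || ((i : nat) == B) then gam else 0) * G i = gam * (G 0 + G B).
  rewrite (bigD1 (Ordinal K0)) //= (bigD1 (Ordinal BK)) /=; last first.
    by rewrite -val_eqE /= -lt0n.
  rewrite eqxx orbT big1 ?addr0 ?mulrDr// => i /andP[i0 iB].
  by rewrite -!val_eqE /= in i0 iB; rewrite (negbTE i0) (negbTE iB) mul0r.
rewrite -e -big_split /=; apply: eq_bigr => i _; rewrite /residual; ring.
Qed.

(** Conditionally on the marks and the ordinary letters, the walk is a
    translate of B times a binomial variable. *)
Lemma zwalk_bernoulli_part K n x : (B < K)%N ->
  zwalk K n x = \sum_(l <- seqs (letters K) n)
    (\prod_(c <- l) letter_weight c) * half_binomial (marks l) (x - (visible_sum l)%:Z).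
Proof.
move=> BK; elim: n x => [|n IH] x.
  by rewrite zwalk0 /= big_seq1 big_nil mul1r subr0.
rewrite zwalkS (sum_residual (fun i => zwalk K n (x - i%:Z)) BK) (big_seqsS _ _ xpredT) sum_letters.
congr (_ + _).
  rewrite subr0 !IH -big_split big_distrr /=; apply: eq_bigr => l _.
  rewrite big_cons /marks /visible_sum /= !add0n [x - _ - B%:Z]addrAC.
  by field.
apply: eq_bigr => i _; rewrite IH big_distrr /=; apply: eq_bigr => l _.
rewrite big_cons /= mulrA; congr (_ * half_binomial _ _).
by rewrite /visible_sum /= PoszD opprD addrA.
Qed.

Section Moments.
Context (v : R) (v_gt0 : 0 < v) (K : nat) (BK : (B < K)%N).
Hypothesis mass_le : \sum_(i < K) p i <= 1.
Hypothesis mean_le : \sum_(i < K) p i * i%:R <= 1.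
Hypothesis fact2_le : \sum_(i < K) p i * (i%:R * i.-1%:R) <= v.
Hypothesis mass_ge : 1 - v / K%:R ^+ 2 <= \sum_(i < K) p i.
Hypothesis mean_ge : 1 - v / K%:R <= \sum_(i < K) p i * i%:R.

Lemma sum_letter_weight : \sum_(c <- letters K) letter_weight c = \sum_(i < K) p i.
Proof.
rewrite sum_letters /=; have := sum_residual (fun=> 1) BK; rewrite /=.
under eq_bigr do rewrite mulr1; under [in RHS]eq_bigr do rewrite mulr1.
by move=> ->; ring.
Qed.

Let K0 : 0 < K%:R :> R. Proof. by rewrite ltr0n; apply: leq_trans BK. Qed.
Let K1 : 1 <= K%:R :> R. Proof. by rewrite ler1n; apply: leq_trans BK. Qed.

Let mass_ge' : 1 - v / K%:R <= \sum_(i < K) p i.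
Proof.
apply: le_trans mass_ge; rewrite lerD2l lerN2 ler_wpM2l ?(ltW v_gt0)//.
rewrite lef_pV2 ?posrE ?exprn_gt0// expr2 ler_pMl//.
Qed.

Let gam_le : 2 * gam <= 1.
Proof.
apply: le_trans mass_le; rewrite -sum_letter_weight sum_letters /= lerDl sumr_ge0// => i _.
exact: residual_ge0.
Qed.

Lemma few_marks n : (0 < n <= K)%N ->
  seq_sum (letters K) letter_weight n (fun l => (marks l)%:R < gam * n%:R) <=
  (1 + v ^+ 2) / gam ^+ 2 / n%:R.
Proof.
move=> /andP[n0 nK]; have nR : 0 < n%:R :> R by rewrite ltr0n.
pose x (c : option nat) : R := (c == None)%:R - 2 * gam.
have sx l : xsum x l = (marks l)%:R - 2 * gam * (size l)%:R.
  elim: l => [|c l IH]; first by rewrite /xsum big_nil mulr0 subr0.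
  rewrite /xsum big_cons -/(xsum x l) IH /= natrD -natr1 /x; ring.
have m1 : `|\sum_(c <- letters K) letter_weight c * x c| <= v / K%:R.
  rewrite (_ : \sum_(c <- _) _ = 2 * gam * (1 - \sum_(i < K) p i)); last first.
    rewrite -sum_letter_weight !sum_letters /= /x /=.
    under eq_bigr do rewrite sub0r mulrN; rewrite sumrN -big_distrl /=; ring.
  have h : 0 <= 1 - \sum_(i < K) p i <= v / K%:R.
    by apply/andP; split; have := mass_ge'; have := mass_le; lra.
  have /andP[h1 h2] := h.
  rewrite ger0_norm ?mulr_ge0 ?(ltW gam_gt0)//; apply: le_trans h2.
  by rewrite ler_piMl.
have m2 : \sum_(c <- letters K) letter_weight c * x c ^+ 2 <= 1.
  apply: le_trans mass_le; rewrite -sum_letter_weight; apply: ler_sum => c _.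
  rewrite ler_piMr ?letter_weight_ge0// -[leRHS](expr1n _ 2) -[leLHS]real_normK ?num_real//.
  rewrite lerXn2r ?nnegrE// ler_norml /x; have := gam_gt0.
  by case: (c == None) => /=; move: gam_le => gl g0; apply/andP; split; lra.
have := @chebyshev_seq_sum _ _ (letters K) letter_weight letter_weight_ge0 x n (v / K%:R) 1 (gam * n%:R).
rewrite sum_letter_weight => /(_ mass_le m1 m2 (mulr_ge0 (ltW gam_gt0) (ltW nR))).
set W := seq_sum _ _ _ _; set W' := seq_sum _ _ _ _ => h.
have W'W : W' <= W.
  rewrite /W /W' /seq_sum [leLHS]big_mkcond [leRHS]big_mkcond /=.
  rewrite big_seq [leRHS]big_seq; apply: ler_sum => l; rewrite mem_seqs => /andP[/eqP sl _].
  have p0 : 0 <= \prod_(c <- l) letter_weight c by rewrite prodr_ge0// => c _; exact: letter_weight_ge0.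
  case: ifP => [mg|_]; last by case: ifP.
  rewrite sx sl ltr0_norm; first by rewrite ifT//; lra.
  by have := mulr_gt0 gam_gt0 nR; lra.
apply: le_trans W'W _; rewrite -[_ / _ / _]mulrA -invfM ler_pdivlMr ?mulr_gt0 ?exprn_gt0//.
rewrite -(ler_pM2r nR).
have -> : W * (gam ^+ 2 * n%:R) * n%:R = (gam * n%:R) ^+ 2 * W by ring.
apply: le_trans h _; rewrite mulr1 mulrDl mul1r lerD2l.
have h : n%:R * (v / K%:R) <= v.
  by rewrite mulrCA ler_piMr ?(ltW v_gt0)// ler_pdivrMr// mul1r ler_nat.
rewrite -[leRHS]mulr1 -mulrA; apply: (@le_trans _ _ (v ^+ 2)).
  by rewrite lerXn2r ?nnegrE ?mulr_ge0 ?divr_ge0 ?(ltW v_gt0).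
by rewrite mulr1 ler_peMr ?sqr_ge0// ler1n.
Qed.

(** The number of marks is at least of order n outside an event of probability
    O(1/n), and then the binomial law is bounded by O(n^(-1/2)). *)
Lemma zwalk_le n x : (0 < n <= K)%N -> zwalk K n x <=
  (1 / Num.sqrt gam + (1 + v ^+ 2) / gam ^+ 2) / Num.sqrt n%:R.
Proof.
move=> nn; have /andP[n0 nK] := nn; have nR : 0 < n%:R :> R by rewrite ltr0n.
rewrite zwalk_bernoulli_part// mulrDl.
apply: (@le_trans _ _ (1 / Num.sqrt (gam * n%:R) * seq_sum (letters K) letter_weight n xpredT +
   seq_sum (letters K) letter_weight n (fun l => (marks l)%:R < gam * n%:R))).
  rewrite /seq_sum big_distrr /= [X in _ <= _ + X]big_mkcond -big_split /=.
  apply: ler_sum => l _.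
  have p0 : 0 <= \prod_(c <- l) letter_weight c by rewrite prodr_ge0// => c _; exact: letter_weight_ge0.
  case: ltP => mg.
    apply: (@le_trans _ _ (\prod_(c <- l) letter_weight c)); first by rewrite ler_piMr// half_binomial_le1.
    by rewrite lerDr mulr_ge0// divr_ge0// sqrtr_ge0.
  rewrite addr0 mulrC ler_wpM2r//.
  have gn : 0 < gam * n%:R by rewrite mulr_gt0.
  have m0 : (0 < marks l)%N by rewrite -(ltr0n R); exact: lt_le_trans mg.
  apply: le_trans (half_binomial_le _ m0) _.
  by rewrite !mul1r lef_pV2 ?posrE ?sqrtr_gt0 ?ltr0n// ler_wsqrtr.
apply: lerD.
  rewrite seq_sumT sqrtrM ?(ltW gam_gt0)// invfM mulrA; apply: ler_piMr.
    by rewrite !mulr_ge0 ?invr_ge0 ?sqrtr_ge0.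
  by rewrite /letter_sum sum_letter_weight exprn_ile1// sumr_ge0.
apply: le_trans (few_marks nn) _; rewrite ler_wpM2l//.
  by rewrite divr_ge0 ?addr_ge0 ?sqr_ge0.
rewrite lef_pV2 ?posrE ?sqrtr_gt0//.
rewrite -[leRHS]sqr_sqrtr ?(ltW nR)// expr2 ler_peMr ?sqrtr_ge0//.
by rewrite -[leLHS]sqrtr1 ler_wsqrtr// ler1n.
Qed.

(** The conditional mean of the walk, given the word of letters and marks, minus
    its length. *)
Definition mean_deviation (l : seq (option nat)) : R :=
  (visible_sum l)%:R + B%:R / 2 * (marks l)%:R - (size l)%:R.

Lemma far_mean n L : (0 < n <= K)%N -> 0 < L ->
  seq_sum (letters K) letter_weight n (fun l => L * Num.sqrt n%:R < `|mean_deviation l|) <=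
  (v + 1 + v ^+ 2) / L ^+ 2.
Proof.
move=> /andP[n0 nK] L0; have nR : 0 < n%:R :> R by rewrite ltr0n.
pose x (c : option nat) : R := (if c is Some i then i%:R else B%:R / 2) - 1.
have sx l : xsum x l = mean_deviation l.
  elim: l => [|c l IH]; first by rewrite /xsum big_nil /mean_deviation /= mulr0 addr0 subr0.
  rewrite /xsum big_cons -/(xsum x l) IH /mean_deviation /= /visible_sum /= !natrD -natr1 /x.
  by case: c => [i|] /=; rewrite ?add0r ?mulrDr; ring.
have m1 : `|\sum_(c <- letters K) letter_weight c * x c| <= v / K%:R.
  rewrite (_ : \sum_(c <- _) _ = \sum_(i < K) p i * i%:R - \sum_(i < K) p i); last first.
    rewrite -sumrB; transitivity (\sum_(i < K) p i * (i%:R - 1)).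
      rewrite (sum_residual (fun i => i%:R - 1) BK) sum_letters /x /=; congr (_ + _).
      by rewrite sub0r; field.
    by apply: eq_bigr => i _; rewrite mulrBr mulr1.
  rewrite ler_norml; apply/andP; split; have := mass_ge'; have := mass_le; have := mean_le; have := mean_ge; lra.
have m2 : \sum_(c <- letters K) letter_weight c * x c ^+ 2 <= v + 1.
  apply: (@le_trans _ _ (\sum_(i < K) p i * (i%:R - 1) ^+ 2)).
    rewrite (sum_residual (fun i => (i%:R - 1) ^+ 2) BK) sum_letters /x /= lerD2r.
    rewrite mulrC mulrA (mulrC _ gam) -mulrA ler_wpM2l ?(ltW gam_gt0)//.
    have := sqr_ge0 (B%:R : R); rewrite sub0r; set b : R := B%:R; lra.
  apply: (@le_trans _ _ (\sum_(i < K) p i * (i%:R * i.-1%:R) + \sum_(i < K) p i)).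
    rewrite -big_split /=; apply: ler_sum => i _; rewrite -[X in _ <= _ + X]mulr1 -mulrDr.
    rewrite ler_wpM2l//; case: (i : nat) => [|j] /=; first by rewrite mul0r; lra.
    rewrite -natr1; have : 0 <= (j%:R : R) by [].
    by set z : R := j%:R; lra.
  by have := mass_le; have := fact2_le; lra.
have s0 : 0 < Num.sqrt n%:R :> R by rewrite sqrtr_gt0.
have := @chebyshev_seq_sum _ _ (letters K) letter_weight letter_weight_ge0 x n (v / K%:R) (v + 1) (L * Num.sqrt n%:R).
rewrite sum_letter_weight => /(_ mass_le m1 m2 (mulr_ge0 (ltW L0) (ltW s0))).
rewrite (eq_seq_sum _ _ _ (g' := fun l => L * Num.sqrt n%:R < `|mean_deviation l|)); last first.
  by move=> l; rewrite sx.
set W := seq_sum _ _ _ _ => h.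
rewrite ler_pdivlMr ?exprn_gt0// -(ler_pM2r nR).
have -> : W * L ^+ 2 * n%:R = (L * Num.sqrt n%:R) ^+ 2 * W.
  by rewrite exprMn sqr_sqrtr ?(ltW nR)//; ring.
apply: le_trans h _; rewrite mulrC [leRHS]mulrDl lerD2l.
have h : n%:R * (v / K%:R) <= v.
  by rewrite mulrCA ler_piMr ?(ltW v_gt0)// ler_pdivrMr// mul1r ler_nat.
apply: (@le_trans _ _ (v ^+ 2)).
  by rewrite lerXn2r ?nnegrE ?mulr_ge0 ?divr_ge0 ?(ltW v_gt0).
by rewrite ler_peMr ?sqr_ge0// ler1n.
Qed.

(** Chebyshev's inequality for the number of marks and for the conditional mean;
    the term v/n accounts for the mass lost by truncating the steps. *)
Lemma typical_mass n L : (0 < n <= K)%N -> 0 < L ->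
  1 - v / n%:R - (v + 1 + v ^+ 2) / L ^+ 2 - (1 + v ^+ 2) / gam ^+ 2 / n%:R <=
  seq_sum (letters K) letter_weight n
    (fun l => (gam * n%:R <= (marks l)%:R) && (`|mean_deviation l| <= L * Num.sqrt n%:R)).
Proof.
move=> nn L0; have /andP[n0 nK] := nn; have nR : 0 < n%:R :> R by rewrite ltr0n.
have h1 := few_marks nn; have h2 := far_mean nn L0.
have h3 : 1 - v / n%:R <= seq_sum (letters K) letter_weight n xpredT.
  rewrite seq_sumT /letter_sum sum_letter_weight.
  have h : 0 <= 1 - \sum_(i < K) p i <= 1.
    by rewrite subr_ge0 mass_le gerBl sumr_ge0.
  have := bernoulli_lower n h; rewrite subKr; apply: le_trans.
  rewrite lerD2l lerN2; apply: (@le_trans _ _ (n%:R * (v / K%:R ^+ 2))).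
    by rewrite ler_wpM2l//; have := mass_ge; lra.
  rewrite mulrCA ler_wpM2l ?(ltW v_gt0)// ler_pdivrMr ?exprn_gt0//.
  rewrite mulrC ler_pdivlMr// -expr2 lerXn2r ?nnegrE// ler_nat//.
suff : seq_sum (letters K) letter_weight n xpredT <=
  seq_sum (letters K) letter_weight n
    (fun l => (gam * n%:R <= (marks l)%:R) && (`|mean_deviation l| <= L * Num.sqrt n%:R)) +
  seq_sum (letters K) letter_weight n (fun l => (marks l)%:R < gam * n%:R) +
  seq_sum (letters K) letter_weight n (fun l => L * Num.sqrt n%:R < `|mean_deviation l|) by lra.
rewrite /seq_sum [X in _ <= X + _ + _]big_mkcond [X in _ <= _ + X + _]big_mkcond.
rewrite [X in _ <= _ + X]big_mkcond -!big_split /=; apply: ler_sum => l _.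
have p0 : 0 <= \prod_(c <- l) letter_weight c by rewrite prodr_ge0// => c _; exact: letter_weight_ge0.
by case: ltP => _ /=; case: ltP => _ /=; lra.
Qed.

End Moments.

(** Sums of letters of positive probability need not fill all residues modulo
    B, but those that occur at all are reached by words of one common length,
    since 0 is a letter and pads shorter words. *)
Lemma residue_words (p0 : 0 < p 0) : exists l0 S c, 0 < c /\
  forall u, all (fun i => 0 < p i) u -> exists w,
    [/\ size w = l0, (sumn w <= S)%N, c <= wword p w & sumn w = sumn u %[mod B]].
Proof.
have B0 : (0 < B)%N by apply: leq_trans B_ge2.
have [U [Upos UP]] : exists U : seq (seq nat),
    (forall w, w \in U -> all (fun i => 0 < p i) w) /\
    forall u, all (fun i => 0 < p i) u ->
      exists2 w, w \in U & sumn w = sumn u %[mod B].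
  suff [U [h1 h2]] : exists U : seq (seq nat),
    (forall w, w \in U -> all (fun i => 0 < p i) w) /\
    forall u, all (fun i => 0 < p i) u -> (sumn u %% B < B)%N ->
      exists2 w, w \in U & sumn w = sumn u %[mod B].
    by exists U; split=> // u au; apply: h2 => //; rewrite ltn_mod.
  move: {2}B => b; elim: b => [|b [U [h1 h2]]]; first by exists [::].
  case: (pselect (exists2 u, all (fun i => 0 < p i) u & (sumn u %% B = b)%N)).
    move=> [u au ub]; exists (u :: U); split=> [w|u' au'].
      by rewrite inE => /predU1P[->|/h1].
    rewrite ltnS leq_eqVlt => /predU1P[e|/(h2 _ au')[w wU e]].
      by exists u; rewrite ?mem_head// ub e.
    by exists w; rewrite ?inE ?wU ?orbT.
  move=> nb; exists U; split=> // u au; rewrite ltnS leq_eqVlt => /predU1P[e|].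
    by exfalso; apply: nb; exists u.
  exact: h2.
have [l lU] : exists l, forall w, w \in U -> (size w <= l)%N /\ (sumn w <= l)%N.
  elim: U {UP Upos} => [|w U [l IH]]; first by exists 0%N.
  exists (maxn l (maxn (size w) (sumn w))) => w'; rewrite inE => /predU1P[->|/IH].
    by rewrite !leq_max !leqnn !orbT.
  by rewrite !leq_max => -[-> ->].
pose pad (w : seq nat) := w ++ nseq (l - size w) 0%N.
have [c c0 cU] : exists2 c, 0 < c & forall w, w \in U -> c <= wword p (pad w).
  elim: U {UP lU} Upos => [|w U IH] h; first by exists 1.
  have [|c c0 hc] := IH; first by move=> w' w'U; apply: h; rewrite inE w'U orbT.
  exists (Num.min (wword p (pad w)) c) => [|w'].
    rewrite lt_min c0 andbT /wword big_seq; apply: prodr_gt0 => i.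
    rewrite mem_cat mem_nseq => /orP[iw|/andP[_ /eqP->//]].
    by have /allP/(_ i iw) := h w (mem_head _ _).
  by rewrite inE ge_min => /predU1P[->|/hc ->]; rewrite ?lexx ?orbT.
exists l, l, c; split=> // u au; have [w wU e] := UP u au.
have [sw tw] := lU w wU; have sp : sumn (pad w) = sumn w.
  by rewrite /pad sumn_cat sumn_nseq mul0n addn0.
exists (pad w); rewrite sp; split=> //; last exact: cU.
by rewrite size_cat size_nseq subnKC.
Qed.

End LatticeWalk.

(** * A local limit estimate *)

Lemma threshold_split (l0 N1 N2 B S n : nat) : (l0 + (N1 + N2 + B + S).+1 <= n)%N ->
  [/\ n = (l0 + (n - l0))%N, (N1 <= n - l0)%N, (N2 <= n - l0)%N, (B < n)%N & (S < n)%N] /\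
  (0 < n - l0 <= n)%N.
Proof. by move=> h; split; [split|]; lia. Qed.

Section LocalLimit.
Context {R : realType}.

Lemma natr_large (a : R) : exists N : nat, forall n : nat, (N <= n)%N -> a <= n%:R.
Proof.
exists (Num.bound `|a|) => n Nn; apply: le_trans (ler_norm a) _.
by apply: le_trans (ltW (archi_boundP (normr_ge0 a))) _; rewrite ler_nat.
Qed.

(** A symmetric binomial law of size at least gam n has mass of order n^(-1/2)
    at each point within O(sqrt n) of its mean; an odd size is reduced to the
    even one below it. *)
Lemma bin_window (L gam : R) : 1 <= L -> 0 < gam -> exists2 c, 0 < c &
  exists N, forall n m j : nat, (N <= n)%N -> gam * n%:R <= m%:R -> (m <= n)%N ->
    `|j%:R - m%:R / 2| <= L * Num.sqrt n%:R ->
    c / Num.sqrt n%:R <= 'C(m, j)%:R / 2 ^+ m :> R.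
Proof.
move=> L1 g0; have L'0 : 0 < 16 * L ^+ 2 / gam.
  by rewrite divr_gt0// mulr_gt0// exprn_gt0//; lra.
have [c c0 [h0 hc]] := bin_off_center L'0.
exists (c / 2); first by rewrite divr_gt0.
have [N hN] := natr_large (2 / gam + 4 * h0%:R / gam + 1).
exists N => n m j /hN nN gm mn jm.
have t1 : 0 <= 2 / gam by rewrite divr_ge0// ltW.
have t2 : 0 <= 4 * h0%:R / gam by rewrite divr_ge0 ?mulr_ge0// ltW.
have n1 : 1 <= n%:R :> R by lra.
have gn2 : 2 <= gam * n%:R by rewrite mulrC -ler_pdivrMr//; lra.
have gnh : 4 * h0%:R <= gam * n%:R by rewrite [leRHS]mulrC -ler_pdivrMr//; lra.
have [h [b e]] : exists h b, m = (nat_of_bool b + h.*2)%N.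
  by exists m./2, (odd m); rewrite odd_double_half.
have b0 : 0 <= (b : nat)%:R :> R by exact: ler0n.
have b1 : (b : nat)%:R <= 1 :> R by rewrite lern1 leq_b1.
have eR : m%:R = b%:R + 2 * h%:R :> R by rewrite e natrD -mul2n natrM.
have hg : gam * n%:R / 4 <= h%:R.
  by lra.
have hh : (h0 <= h)%N by rewrite -(ler_nat R); lra.
have s1 : 1 <= Num.sqrt n%:R :> R by rewrite -[leLHS]sqrtr1 ler_wsqrtr.
pose d := (if (h <= j)%N then j - h else h - j)%N.
have dR : d%:R = `|j%:R - h%:R| :> R.
  rewrite /d; case: leqP => jh; rewrite natrB// ?(ltnW jh)//.
    by rewrite ger0_norm// subr_ge0 ler_nat.
  by rewrite distrC ger0_norm// subr_ge0 ler_nat ltnW.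
have dL : d%:R <= 2 * L * Num.sqrt n%:R :> R.
  rewrite dR; apply: (@le_trans _ _ (`|j%:R - m%:R / 2| + 1)).
    have -> : j%:R - h%:R = (j%:R - m%:R / 2) + b%:R / 2 :> R by rewrite eR; field.
    apply: le_trans (ler_normD _ _) _; rewrite lerD2l ger0_norm; lra.
  have : 1 <= L * Num.sqrt n%:R by rewrite -[leLHS]mulr1 ler_pM.
  lra.
have d2 : d%:R ^+ 2 <= 16 * L ^+ 2 / gam * h%:R.
  apply: (@le_trans _ _ ((2 * L * Num.sqrt n%:R) ^+ 2)).
    by rewrite lerXn2r ?nnegrE// !mulr_ge0 ?sqrtr_ge0//; lra.
  rewrite exprMn sqr_sqrtr//.
  apply: (@le_trans _ _ (16 * L ^+ 2 / gam * (gam * n%:R / 4))); last first.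
    by rewrite ler_wpM2l// ltW.
  by rewrite le_eqVlt; apply/orP; left; apply/eqP; field; rewrite gt_eqF.
have jd : (j = h + d \/ j + d = h)%N.
  by rewrite /d; case: (leqP h j) => jh; [left; rewrite subnKC|right; rewrite subnKC// ltnW].
have main := hc h j d hh d2 jd.
have hpos : 0 < h%:R :> R by lra.
have hn : h%:R <= n%:R :> R by rewrite ler_nat; apply: leq_trans mn; rewrite e (leq_trans _ (leq_addl _ _))// -addnn leq_addr.
apply: (@le_trans _ _ (c / Num.sqrt h%:R / 2)).
  rewrite mulrAC ler_wpM2r// ler_wpM2l ?(ltW c0)// lef_pV2 ?posrE ?sqrtr_gt0//; last lra.
  exact: ler_wsqrtr.
apply: (@le_trans _ _ ('C(h.*2, j)%:R / 4 ^+ h / 2)); first by rewrite ler_wpM2r.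
have e4 : 2 ^+ h.*2 = 4 ^+ h :> R by rewrite -mul2n exprM; congr (_ ^+ _); ring.
rewrite e; case: (b).
  rewrite add1n exprS e4 invfM mulrA -[leLHS]mulrA -[leRHS]mulrA (mulrC _ 2^-1) [leRHS]mulrA -mulrA.
  rewrite ler_wpM2r ?mulr_ge0 ?invr_ge0 ?exprn_ge0// ler_nat.
  by case: (j) => [|k]; rewrite ?bin0// binS leq_addr.
rewrite add0n e4 ler_piMr ?divr_ge0 ?exprn_ge0//; lra.
Qed.

Context (p : nat -> R) (p_ge0 : forall i, 0 <= p i) (v : R) (v_gt0 : 0 < v).
Hypothesis mass_le : forall M, \sum_(i < M) p i <= 1.
Hypothesis mean_le : forall M, \sum_(i < M) p i * i%:R <= 1.
Hypothesis fact2_le : forall M, \sum_(i < M) p i * (i%:R * i.-1%:R) <= v.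
Hypothesis mass_ge : forall M, (0 < M)%N -> 1 - v / M%:R ^+ 2 <= \sum_(i < M) p i.
Hypothesis mean_ge : forall M, (0 < M)%N -> 1 - v / M%:R <= \sum_(i < M) p i * i%:R.
Context (B : nat) (B_ge2 : (2 <= B)%N) (p0_gt0 : 0 < p 0) (pB_gt0 : 0 < p B).

Let gam := Num.min (p 0) (p B).
Let gam_gt0 : 0 < gam. Proof. by rewrite lt_min p0_gt0. Qed.
Let gam0 : gam <= p 0. Proof. by rewrite ge_min lexx. Qed.
Let gamB : gam <= p B. Proof. by rewrite ge_min lexx orbT. Qed.

Lemma walk_upper : exists2 C, 0 < C & forall K n x, (B < K)%N -> (0 < n <= K)%N ->
  walk p K n x <= C / Num.sqrt n%:R.
Proof.
exists (1 / Num.sqrt gam + (1 + v ^+ 2) / gam ^+ 2).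
  by rewrite ltr_wpDr ?divr_ge0 ?addr_ge0 ?sqr_ge0// divr_gt0// sqrtr_gt0.
move=> K n x BK nK; rewrite walk_zwalk.
have K0 : (0 < K)%N by apply: leq_trans BK.
exact: (zwalk_le p_ge0 B_ge2 gam_gt0 gam0 gamB v_gt0 BK (mass_le K) (mass_ge K0)).
Qed.

(** The first l0 steps are reserved for the residue: for a typical word of
    the other n - l0 letters they are chosen so that the distance left to n - 1
    is a multiple of B, and the binomial part covers this distance with
    probability of order n^(-1/2). *)
Lemma walk_lower : exists2 c, 0 < c & exists N, forall n, (N <= n)%N ->
  (exists w, [/\ size w = n, sumn w = n.-1 & all (fun i => 0 < p i) w]) ->
  c / Num.sqrt n%:R <= walk p n n n.-1.
Proof.
have [l0 [S [c [c0 hw]]]] := residue_words B_ge2 p0_gt0.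
pose a := v + 1 + v ^+ 2.
have a1 : 1 <= a by have := sqr_ge0 v; rewrite /a; have := v_gt0; lra.
pose L := 2 * a.
have L1 : 1 <= L by rewrite /L; lra.
have [c1 c10 [N1 hN1]] := bin_window L1 gam_gt0.
exists (c * c1 / 2); first by rewrite divr_gt0 ?mulr_gt0.
pose A2 := (1 + v ^+ 2) / gam ^+ 2.
have [N2 hN2] := natr_large (8 * v + 8 * A2 + (l0 + 1 + S)%:R ^+ 2 + (2 * L / gam) ^+ 2 + 1).
exists (l0 + (N1 + N2 + B + S).+1)%N => n nN [w0 [sw0 tw0 pw0]].
have [] := threshold_split nN; set n' := (n - l0)%N => -[en n'N1 n'N2 Bltn Sn] n'n.
have n'0 : (0 < n')%N by have /andP[] := n'n.
have n0 : (0 < n)%N by exact: leq_ltn_trans (leq0n _) Bltn.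
have nbig := hN2 n' n'N2.
have A20 : 0 <= A2 by rewrite divr_ge0 ?addr_ge0 ?sqr_ge0.
have q1 := sqr_ge0 (l0 + 1 + S)%:R : _ <= _ :> R.
have q2 := sqr_ge0 (2 * L / gam).
have n'R : 0 < n'%:R :> R by rewrite ltr0n.
set sn := Num.sqrt n'%:R : R.
have sn2 : sn ^+ 2 = n'%:R by rewrite sqr_sqrtr// ltW.
have sn0 : 0 < sn by rewrite sqrtr_gt0.
have sn1 : (l0 + 1 + S)%:R <= sn.
  by rewrite -(@ler_pXn2r _ 2) ?nnegrE ?(ltW sn0)// sn2; have := v_gt0; lra.
have sn3 : 2 * L <= gam * sn.
  rewrite [leRHS]mulrC -ler_pdivrMr// -(@ler_pXn2r _ 2) ?nnegrE ?(ltW sn0)//.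
    by rewrite sn2; have := v_gt0; lra.
  by apply: divr_ge0; [lra|exact: ltW].
have L0 : 0 < L by lra.
have mass : 1 / 2 <= seq_sum (letters n) (letter_weight p B gam) n'
    (fun l => (gam * n'%:R <= (marks l)%:R) && (`|mean_deviation (R:=R) B l| <= L * sn)).
  apply: le_trans (typical_mass p_ge0 B_ge2 gam_gt0 gam0 gamB v_gt0 Bltn (mass_le n)
    (mean_le n) (fact2_le n) (mass_ge n0) (mean_ge n0) n'n L0).
  have t1 : v / n'%:R <= 1 / 8.
    by rewrite ler_pdivrMr//; have := v_gt0; lra.
  have t2 : A2 / n'%:R <= 1 / 8.
    by rewrite ler_pdivrMr//; have := v_gt0; lra.
  have t3 : a / L ^+ 2 <= 1 / 4.
    rewrite ler_pdivrMr ?exprn_gt0// /L exprMn.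
    have : 1 * a <= a * a by rewrite ler_wpM2r//; lra.
    rewrite mul1r -expr2; lra.
  rewrite -/a -/A2; lra.
rewrite walk_zwalk.
have -> : zwalk p n n n.-1 = zwalk p n (l0 + n') n.-1 by rewrite -en.
rewrite zwalk_cat.
have lw0 := letter_weight_ge0 p_ge0 gam_gt0 gam0 gamB.
under eq_bigr => w2 _ do rewrite (zwalk_bernoulli_part p B_ge2 gam _ _ Bltn) big_distrr.
rewrite exchange_big /=.
pose typ (l : seq (option nat)) := (gam * n'%:R <= (marks l)%:R) && (`|mean_deviation (R:=R) B l| <= L * sn).
apply: (@le_trans _ _ (\sum_(l <- seqs (letters n) n' | typ l)
    (\prod_(x <- l) letter_weight p B gam x) * (c * (c1 / sn)))).
  rewrite -big_distrl /= -/(seq_sum _ _ _ _).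
  have h : c1 / Num.sqrt n%:R <= c1 / sn.
    rewrite ler_wpM2l ?(ltW c10)// lef_pV2 ?posrE ?sqrtr_gt0 ?ltr0n//.
    by rewrite ler_wsqrtr// ler_nat /n' leq_subr.
  have -> : c * c1 / 2 / Num.sqrt n%:R = 1 / 2 * (c * (c1 / Num.sqrt n%:R)) by ring.
  rewrite ler_pM// ?mulr_ge0 ?invr_ge0 ?sqrtr_ge0 ?(ltW c0) ?(ltW c10)//.
  by rewrite ler_wpM2l// ltW.
rewrite big_mkcond; rewrite big_seq [leRHS]big_seq; apply: ler_sum => l.
rewrite mem_seqs => /andP[/eqP sl ll].
have pl0 : 0 <= \prod_(x <- l) letter_weight p B gam x by rewrite prodr_ge0.
have ww2 w2 : 0 <= wword p w2 * ((\prod_(x <- l) letter_weight p B gam x) *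
    half_binomial (R:=R) B (marks l) (n.-1%:Z - (sumn w2)%:Z - (visible_sum l)%:Z)).
  by rewrite !mulr_ge0 ?wword_ge0 ?half_binomial_ge0.
case: ifP => [/andP[tm td]|_]; last by rewrite sumr_ge0.
have [z|z] := eqVneq (\prod_(x <- l) letter_weight p B gam x) 0.
  by rewrite z mul0r sumr_ge0// => w2 _; rewrite mul0r mulr0.
(* Modulo B, repeating the letters of l B - 1 times amounts to changing the sign
   of their sum; w0 contributes n - 1. *)
pose u := flatten (nseq B.-1 (map (odflt 0%N) l)) ++ w0.
have pu : all (fun i => 0 < p i) u.
  rewrite all_cat pw0 andbT.
  have H : all (fun i => 0 < p i) (map (odflt 0%N) l).
    rewrite all_map; apply/allP => -[i|] il //=.
    apply: lt_le_trans (residual_le p B gam_gt0 i).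
    have := prodf_seq_neq0 l xpredT (letter_weight p B gam).
    rewrite z => /esym/allP/(_ _ il) /=.
    by rewrite lt_neqAle eq_sym (residual_ge0 p_ge0 gam0 gamB) => ->.
  by elim: (B.-1) => //= k IH; rewrite all_cat H.
have su : sumn u = (B.-1 * visible_sum l + n.-1)%N.
  rewrite /u sumn_cat tw0; congr addn.
  by elim: (B.-1) => //= k IH; rewrite sumn_cat IH mulSn.
have [w2 [sw2 tw2 cw2 ew2]] := hw u pu.
have cong : (sumn w2 + visible_sum l = n.-1 %[mod B])%N.
  rewrite -modnDml ew2 modnDml su addnAC -[X in (_ * _ + X + _)%N]mul1n -mulnDl addn1.
  by rewrite prednK ?(leq_trans _ B_ge2)// [(B * _)%N]mulnC modnMDl.
have ml : (marks l <= n')%N by rewrite -sl /marks count_size.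
have key : gam * n'%:R <= (n.-1)%:R - (sumn w2 + visible_sum l)%:R + 2 * L * sn /\
  `|(n.-1)%:R - (sumn w2 + visible_sum l)%:R - B%:R / 2 * (marks l)%:R| <= 2 * L * sn.
  have e1 : (n.-1)%:R - (sumn w2 + visible_sum l)%:R - B%:R / 2 * (marks l)%:R =
     (l0%:R - 1 - (sumn w2)%:R) - mean_deviation (R:=R) B l.
    rewrite /mean_deviation sl natrD.
    have -> : (n.-1)%:R = l0%:R + n'%:R - 1 :> R.
      by rewrite -natrD -en -[X in X%:R - 1](prednK n0) -natr1 addrK.
    ring.
  have h2 : `|(n.-1)%:R - (sumn w2 + visible_sum l)%:R - B%:R / 2 * (marks l)%:R| <= 2 * L * sn.
    rewrite e1; apply: le_trans (ler_normB _ _) _.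
    have h3 : `|l0%:R - 1 - (sumn w2)%:R| <= sn.
      apply: le_trans sn1; rewrite !natrD.
      have : (sumn w2)%:R <= S%:R :> R by rewrite ler_nat.
      have : 0 <= (sumn w2)%:R :> R by [].
      have : 0 <= l0%:R :> R by [].
      have : 0 <= S%:R :> R by [].
      by move=> h4 h5 h6 h7; rewrite ler_norml; apply/andP; split; lra.
    have : 1 * sn <= L * sn by rewrite ler_wpM2r// ltW.
    lra.
  split=> //.
  have : 1 * (marks l)%:R <= B%:R / 2 * (marks l)%:R :> R.
    rewrite ler_wpM2r//; have : 2 <= B%:R :> R by rewrite ler_nat.
    lra.
  move: h2; rewrite ler_norml => /andP[h2 _]; lra.
have [k1 k2] := key.
have le1 : (sumn w2 + visible_sum l <= n.-1)%N.
  rewrite -(ler_nat R).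
  have : 2 * L * sn <= gam * sn * sn by rewrite ler_wpM2r// ltW.
  rewrite -[gam * sn * sn]mulrA -expr2 sn2; lra.
have [j ej] : exists j, (n.-1 - (sumn w2 + visible_sum l) = B * j)%N.
  have : (B %| n.-1 - (sumn w2 + visible_sum l))%N.
    by rewrite -eqn_mod_dvd// cong.
  by move=> /dvdnP[j e]; exists j; rewrite e mulnC.
have Bj : c1 / sn <= half_binomial (R:=R) B (marks l) (n.-1%:Z - (sumn w2)%:Z - (visible_sum l)%:Z).
  rewrite -addrA -opprD -PoszD subzn// ej half_binomial_mul//; apply: hN1 => //.
  have B0 : 0 < B%:R :> R by rewrite ltr0n (leq_trans _ B_ge2).
  have B2 : 2 <= B%:R :> R by rewrite ler_nat.
  move: k2; rewrite -natrB// ej natrM.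
  have -> : B%:R * j%:R - B%:R / 2 * (marks l)%:R = B%:R * (j%:R - (marks l)%:R / 2) :> R.
    by field.
  rewrite normrM (gtr0_norm B0) => k2.
  have : 2 * `|j%:R - (marks l)%:R / 2| <= B%:R * `|j%:R - (marks l)%:R / 2| :> R.
    by rewrite ler_wpM2r.
  rewrite -/sn; lra.
have w2in : w2 \in seqs (iota 0 n) l0.
  rewrite mem_seqs sw2 eqxx; apply/allP => i /leq_sumn iw /=.
  by rewrite mem_iota add0n (leq_ltn_trans (leq_trans iw tw2) Sn).
rewrite (big_rem _ w2in) /=; apply: ler_wpDr; first by rewrite sumr_ge0.
rewrite [leRHS]mulrCA ler_wpM2l// ler_pM ?divr_ge0 ?(ltW c0) ?(ltW c10) ?(ltW sn0)//.
Qed.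

End LocalLimit.

(** * The law of the Galton-Watson tree *)

(** The Ulam-Harris addresses of the nodes. *)
Fixpoint nodes (t : tree) : seq (seq nat) :=
  let: Node s := t in
  [::] :: [seq j :: u | j <- iota 0 (size s), u <- nth [::] (map nodes s) j].

Definition degree (t : tree) (u : seq nat) : nat :=
  if subtree t u is Some (Node s) then size s else 0%N.

Lemma nodesE s : nodes (Node s) =
  [::] :: [seq j :: u | j <- iota 0 (size s), u <- nth [::] (map nodes s) j].
Proof. by []. Qed.

Lemma nth_nodes s j : (j < size s)%N ->
  nth [::] (map nodes s) j = nodes (nth (Node [::]) s j).
Proof. exact: nth_map. Qed.

Lemma subtree_cons s j u : (j < size s)%N ->
  subtree (Node s) (j :: u) = subtree (nth (Node [::]) s j) u.
Proof. by move=> js /=; rewrite onthE (nth_map (Node [::])). Qed.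

Lemma mem_nodes t u : (u \in nodes t) = (subtree t u != None).
Proof.
elim/tree_memind: t u => s IH [|j u]; first by rewrite inE eqxx.
rewrite nodesE inE orFb; case: (ltnP j (size s)) => js.
  rewrite -[X in _ = (X != None)]/(subtree (Node s) (j :: u)).
  rewrite subtree_cons// -IH ?mem_nth//.
  apply/allpairsPdep/idP => [[j' [u' [_ h [e1 e2]]]]|uj].
    by move: h; rewrite -e1 -e2 nth_nodes.
  by exists j, u; rewrite mem_iota add0n js nth_nodes.
rewrite /= onth_default//=; apply/negbTE/allpairsPdep => -[j' [u' [+ _ [e _]]]].
by rewrite mem_iota add0n -e ltnNge js.
Qed.

Lemma uniq_nodes t : uniq (nodes t).
Proof.
elim/tree_memind: t => s IH /=; apply/andP; split.
  by apply/allpairsPdep => -[? [? []]].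
apply: allpairs_uniq_dep; first exact: iota_uniq.
  by move=> j; rewrite mem_iota add0n => /= js; rewrite nth_nodes// IH// mem_nth.
by move=> [j u] [j' u'] _ _ [-> ->].
Qed.

Lemma generatesE (f : seq nat -> nat) t :
  generates f t <-> forall u, u \in nodes t -> f u = degree t u.
Proof.
split=> [g u|g u s E].
  rewrite mem_nodes /degree; case E: (subtree t u) => [[s]|]// _.
  by rewrite (g _ _ E).
by rewrite g ?mem_nodes ?E// /degree E.
Qed.

(** Independence gives a product over the addresses of the nodes, whereas the
    weight of a tree is a product over its code. *)
Lemma prod_nodes (R : realFieldType) (p : nat -> R) t :
  \prod_(u <- nodes t) p (degree t u) = wtree p t.
Proof.
elim/tree_memind: t => s IH; rewrite wtree_node nodesE big_cons; congr (_ * _).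
rewrite big_allpairs_dep /= [RHS](big_nth (Node [::])) /index_iota subn0.
rewrite big_seq [RHS]big_seq; apply: eq_bigr => j; rewrite mem_iota add0n => /= js.
rewrite nth_nodes// -IH ?mem_nth//; apply: eq_bigr => u _.
by rewrite /degree subtree_cons.
Qed.

Section GaltonWatsonLaw.
Context {R : realType} {d0 : measure_display} {Om0 : measurableType d0}
  {P0 : probability Om0 R} (xi : {RV P0 >-> nat})
  {d : measure_display} {Om : measurableType d} {P : probability Om R}
  (X : seq nat -> {RV P >-> nat}) (gwX : galton_watson xi X).

Definition offspring (i : nat) : R := fine (P0 (xi @^-1` [set i])).

Lemma offspringE i : P0 (xi @^-1` [set i]) = (offspring i)%:E.
Proof. by rewrite /offspring fineK// fin_num_measure//; exact: measurable_funPTI. Qed.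

Lemma offspring_ge0 i : 0 <= offspring i.
Proof. by rewrite fine_ge0. Qed.

Definition tree_event t : set Om := [set w | generates (fun u => X u w) t].

Lemma tree_eventE t : tree_event t =
  \bigcap_(u in [set` nodes t]) (X u @^-1` [set degree t u]).
Proof. by apply/seteqP; split=> w /generatesE. Qed.

Lemma measurable_tree_event t : measurable (tree_event t).
Proof.
rewrite tree_eventE; apply: fin_bigcap_measurable => [|u _]; first exact: finite_seq.
exact: measurable_funPTI.
Qed.

Lemma P_tree_event t : P (tree_event t) = (wtree offspring t)%:E.
Proof.
have [indep law] := gwX.
rewrite tree_eventE (indep (nodes t) (fun u => [set degree t u])) ?uniq_nodes//.
rewrite -prod_nodes -prodEFin; apply: eq_bigr => u _.
by rewrite -offspringE; exact: law.
Qed.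

Lemma P_trees (ts : seq tree) : uniq ts ->
  P [set w | exists2 t, generates (fun u => X u w) t & t \in ts] =
  (\sum_(t <- ts) wtree offspring t)%:E.
Proof.
move=> us.
rewrite (_ : [set w | _] = \bigcup_(t in [set` ts]) tree_event t); last first.
  by apply/seteqP; split=> w [t]; exists t.
rewrite measure_fin_bigcup//=; last 2 first.
- by apply/trivIsetP => t1 t2 _ _ /eqP t12; apply/seteqP; split=> w // [g1 g2];
    apply: t12; exact: generates_unique g1 g2.
- by move=> t _; exact: measurable_tree_event.
rewrite -fsbig_seq// -sumEFin; apply: eq_bigr => t _; exact: P_tree_event.
Qed.

(** Only finitely many trees have n nodes, so the event is a finite union. *)
Lemma gw_in_size (A : set tree) n : gw_in X A `&` gw_in X (has_size n) =
  [set w | exists2 t, generates (fun u => X u w) t & t \in [seq t <- trees_of_size n | `[<A t>]]].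
Proof.
apply/seteqP; split=> w.
  move=> [[t g At] [t' g' tn]]; exists t => //.
  rewrite mem_filter mem_trees_of_size (generates_unique g g'); apply/andP; split; last exact/eqP.
  by apply/asboolP; rewrite -(generates_unique g g').
move=> [t g]; rewrite mem_filter mem_trees_of_size => /andP[/asboolP At /eqP tn].
by split; exists t.
Qed.

Lemma P_gw_in_size (A : set tree) n : P (gw_in X A `&` gw_in X (has_size n)) =
  (\sum_(t <- trees_of_size n | `[<A t>]) wtree offspring t)%:E.
Proof.
rewrite gw_in_size (P_trees (filter_uniq _ (uniq_trees_of_size n))).
by congr (_%:E); rewrite big_filter.
Qed.

Lemma P_gw_size n : P (gw_in X (has_size n)) = (\sum_(t <- trees_of_size n) wtree offspring t)%:E.
Proof.
have := P_gw_in_size (has_size n) n; rewrite setIid => ->; congr (_%:E).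
rewrite big_seq_cond [RHS]big_seq; apply: eq_bigl => t.
rewrite mem_trees_of_size; case: eqP => //= tn.
by rewrite asboolT.
Qed.

Lemma conditioned_prob n (d' : measure_display) (Om' : measurableType d')
    (P' : probability Om' R) (T : {RV P' >-> tree}) (A : set tree) :
  conditioned_gw X n T ->
  P' (T @^-1` A) =
    ((\sum_(t <- trees_of_size n | `[<A t>]) wtree offspring t) /
     (\sum_(t <- trees_of_size n) wtree offspring t))%:E.
Proof.
move=> /(_ A); rewrite /distribution /pushforward => ->.
by rewrite /cond_prob P_gw_in_size P_gw_size.
Qed.

Lemma admissible_word n : admissible X n -> exists w,
  [/\ size w = n, sumn w = n.-1 & all (fun i => 0 < offspring i) w].
Proof.
rewrite /admissible /= P_gw_size lte_fin => pos.
have [t tn wt] : exists2 t, t \in trees_of_size n & wtree offspring t != 0.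
  apply/hasP; apply: contraTT pos => /hasPn h; rewrite -leNgt big_seq big1// => t tn.
  by apply/eqP; have := h t tn; rewrite negbK.
move: tn; rewrite mem_trees_of_size => /eqP tn; exists (code t); rewrite size_code; split=> //.
  by rewrite -tn -sumn_code.
apply/allP => i it; rewrite lt_neqAle offspring_ge0 andbT eq_sym.
move: wt; rewrite /wtree /wword prodf_seq_neq0 => /allP/(_ i it).
exact.
Qed.

End GaltonWatsonLaw.

(** * Moments of the offspring law *)

Section Series.
Context {R : realType} {d0 : measure_display} {Om0 : measurableType d0}
  {P0 : probability Om0 R} (xi : {RV P0 >-> nat}).

(** The sample space is cut along the values of xi. *)
Lemma expectation_series (g : nat -> R) : (forall i, 0 <= g i) ->
  ('E_P0[fun w => g (xi w)] = \sum_(0 <= i <oo) (offspring xi i * g i)%:E)%E.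
Proof.
move=> g0; rewrite unlock.
have e : [set: Om0] = \bigcup_k (xi @^-1` [set k]).
  by apply/seteqP; split=> w // _; exists (xi w).
rewrite e ge0_integral_bigcup//=; first last.
- by apply/trivIsetP => i j _ _ /eqP ij; apply/seteqP; split=> w // [/= -> ?]; exact: ij.
- by move=> w _; rewrite lee_fin.
- rewrite -e => _ Y mY; rewrite setTI.
  rewrite -[X in measurable X]/(xi @^-1` ((fun i => (g i)%:E) @^-1` Y)).
  exact: measurable_funPTI.
- by move=> k; exact: measurable_funPTI.
apply: eq_eseriesr => i _.
rewrite (eq_integral (cst (g i)%:E)); last by move=> w; rewrite inE /= => ->.
rewrite integral_cst//; last exact: measurable_funPTI.
by rewrite mulrC EFinM -offspringE.
Qed.

Lemma series_cvg (u : nat -> R) (l : R) : (forall i, 0 <= u i) ->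
  (\sum_(0 <= i <oo) (u i)%:E)%E = l%:E -> (fun M => \sum_(i < M) u i) @ \oo --> l.
Proof.
move=> u0 e.
have : (fun n => \sum_(0 <= i < n) (u i)%:E)%E @ \oo --> l%:E.
  rewrite -e; apply: is_cvg_nneseries => i _ _; by rewrite lee_fin.
move=> /fine_cvg; apply: cvg_trans; apply: near_eq_cvg; near=> n.
by rewrite /= sumEFin /= big_mkord.
Unshelve. all: by end_near.
Qed.

End Series.

Section MomentFacts.
Context {R : realType} (p : nat -> R) (s2 : R) (p_ge0 : forall i, 0 <= p i).
Hypothesis s2_gt0 : 0 < s2.
Hypothesis mass : (fun M => \sum_(i < M) p i) @ \oo --> (1 : R).
Hypothesis mean : (fun M => \sum_(i < M) p i * i%:R) @ \oo --> (1 : R).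
Hypothesis var : (fun M => \sum_(i < M) p i * (i%:R - 1) ^+ 2) @ \oo --> s2.

Lemma partial_le (u : nat -> R) l : (forall i, 0 <= u i) ->
  (fun M => \sum_(i < M) u i) @ \oo --> l -> forall M, \sum_(i < M) u i <= l.
Proof.
move=> u0 ul M; rewrite -(cvg_lim _ ul)//.
apply: (nondecreasing_cvgn_le (u_ := fun M => \sum_(i < M) u i)).
  by move=> m n mn; apply: ler_sum_widen.
by apply/cvg_ex; exists l.
Qed.

Lemma partial_ge (u : nat -> R) l e : (forall i, 0 <= u i) ->
  (fun M => \sum_(i < M) u i) @ \oo --> l -> 0 < e ->
  exists K, forall M, (K <= M)%N -> l - e <= \sum_(i < M) u i.
Proof.
move=> u0 ul e0; have := ul => /cvgrPdist_lt/(_ e e0)[K _ hK]; exists K => M KM.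
by have /= := hK M KM; rewrite ltr_norml => /andP[_ h]; lra.
Qed.

Let factorial_momentE M : \sum_(i < M) p i * (i%:R * i.-1%:R) =
  \sum_(i < M) p i * (i%:R - 1) ^+ 2 + \sum_(i < M) p i * i%:R - \sum_(i < M) p i.
Proof.
rewrite -big_split -sumrB /=; apply: eq_bigr => -[[|i] ilt] _ /=; first by ring.
by rewrite -natr1; ring.
Qed.

Lemma factorial_moment : (fun M => \sum_(i < M) p i * (i%:R * i.-1%:R)) @ \oo --> s2.
Proof.
rewrite (_ : (fun M => _) = (fun M => \sum_(i < M) p i * (i%:R - 1) ^+ 2
  + \sum_(i < M) p i * i%:R - \sum_(i < M) p i)); last exact/funext/factorial_momentE.
rewrite -[s2](addrK 1); apply: cvgB mass; exact: cvgD.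
Qed.

Let fact2_ge0 i : 0 <= p i * (i%:R * i.-1%:R). Proof. by rewrite !mulr_ge0. Qed.
Let mean_ge0 i : 0 <= p i * i%:R. Proof. by rewrite mulr_ge0. Qed.

Lemma square_le M : \sum_(i < M) p i * i%:R ^+ 2 <= s2 + 1.
Proof.
rewrite (_ : \sum_(i < M) _ = \sum_(i < M) p i * (i%:R * i.-1%:R) + \sum_(i < M) p i * i%:R).
  by rewrite lerD// ?(partial_le fact2_ge0 factorial_moment)// (partial_le mean_ge0 mean).
rewrite -big_split; apply: eq_bigr => -[[|i] ilt] _ /=; first by rewrite expr0n/=; ring.
by rewrite -natr1; ring.
Qed.

(** Beyond M the terms u_i are at most p_i i^2 / C, and the second moment is
    finite. *)
Lemma truncation_error (u : nat -> R) (M : nat) (C : R) : (0 < M)%N ->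
  (forall i, 0 <= u i) -> (fun M => \sum_(i < M) u i) @ \oo --> (1 : R) ->
  0 < C -> (forall i, (M <= i)%N -> u i * C <= p i * i%:R ^+ 2) ->
  1 - (s2 + 1) / C <= \sum_(i < M) u i.
Proof.
move=> M0 u0 ul C0 h; apply/ler_addgt0Pr => e e0.
have [K hK] := partial_ge u0 ul e0.
have := hK (maxn K M) (leq_maxl _ _).
set N := maxn K M; have MN : (M <= N)%N by exact: leq_maxr.
have tail : (\sum_(i < N) u i - \sum_(i < M) u i) * C <= s2 + 1.
  apply: le_trans (square_le N).
  rewrite -(sum_iota N u) -(sum_iota M u) -(sum_iota N (fun i => p i * i%:R ^+ 2)).
  rewrite -(subnKC MN) iotaD !big_cat /= [X in X * C]addrAC subrr add0r add0n big_distrl /=.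
  apply: ler_wpDl; first by rewrite sumr_ge0// => i _; rewrite mulr_ge0 ?sqr_ge0.
  by rewrite big_seq [leRHS]big_seq; apply: ler_sum => i; rewrite mem_iota => /andP[? _]; exact: h.
have : \sum_(i < N) u i - \sum_(i < M) u i <= (s2 + 1) / C by rewrite ler_pdivlMr.
lra.
Qed.

Lemma mass_trunc M : (0 < M)%N -> 1 - (s2 + 1) / M%:R ^+ 2 <= \sum_(i < M) p i.
Proof.
move=> M0; apply: truncation_error => //; first by rewrite exprn_gt0// ltr0n.
by move=> i Mi; rewrite ler_wpM2l// lerXn2r ?nnegrE// ler_nat.
Qed.

Lemma mean_trunc M : (0 < M)%N -> 1 - (s2 + 1) / M%:R <= \sum_(i < M) p i * i%:R.
Proof.
move=> M0; apply: (truncation_error (u := fun i => p i * i%:R)) => //; first by rewrite ltr0n.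
by move=> i Mi; rewrite -mulrA ler_wpM2l// expr2 ler_wpM2l// ler_nat.
Qed.

(** Otherwise xi takes values in {0, 1}, and mean 1 makes its variance 0. *)
Lemma large_letter : exists2 B, (2 <= B)%N & 0 < p B.
Proof.
case: (pselect (exists2 B, (2 <= B)%N & 0 < p B)) => // nB; exfalso.
have pB B : (2 <= B)%N -> p B = 0.
  move=> B2; apply/eqP; have := p_ge0 B; rewrite le_eqVlt => /predU1P[<-//|pB].
  by exfalso; apply: nB; exists B.
have H (u : nat -> R) (l : R) : (fun M => \sum_(i < M) p i * u i) @ \oo --> l ->
    l = p 0 * u 0 + p 1 * u 1.
  move=> ul; apply: (cvg_unique _ ul) => //; apply: cvg_near_cst.
  exists 2%N => // M /= M2; rewrite -(subnKC M2) !big_ord_recl /= big1 ?addr0// => i _.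
  by rewrite pB ?mul0r// /bump.
have mass' : (fun M => \sum_(i < M) p i * 1) @ \oo --> (1 : R).
  by under eq_fun do under eq_bigr do rewrite mulr1; exact: mass.
have e0 := H (fun=> 1) 1 mass'; have e1 := H (fun i => i%:R) 1 mean.
have e2 := H (fun i => (i%:R - 1) ^+ 2) s2 var.
rewrite /= in e0 e1 e2; have p1 : p 1 = 1 by lra.
have p0 : p 0 = 0 by lra.
have z : s2 = 0 by rewrite e2 p1 p0; ring.
by move: s2_gt0; rewrite z ltxx.
Qed.

(** A positive probability of values at least 2 must be compensated, as the mean
    is 1. *)
Lemma zero_letter : 0 < p 0.
Proof.
have [B B2 pB] := large_letter; apply: (lt_le_trans pB); rewrite -subr_ge0.
apply/ler_addgt0Pr => e e0.
have [K hK] := partial_ge p_ge0 mass e0.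
have := hK (maxn K B.+1) (leq_maxl _ _); have := partial_le mean_ge0 mean (maxn K B.+1).
set N := maxn K _; have BN : (B < N)%N by exact: leq_maxr.
have N0 : (0 < N)%N by exact: leq_ltn_trans BN.
have : \sum_(i < N) p i - \sum_(i < N) p i * i%:R <= p 0 - p B.
  rewrite -sumrB (bigD1 (Ordinal N0)) //= mulr0 subr0 lerD2l (bigD1 (Ordinal BN)) /=; last first.
    by rewrite -val_eqE /= -lt0n; apply: leq_trans B2.
  apply: (@le_trans _ _ (- p B + 0)); last by rewrite addr0.
  apply: lerD.
    have : p B * 2 <= p B * B%:R by rewrite ler_wpM2l// ler_nat.
    lra.
  rewrite sumr_le0// => i /andP[i0 _].
  rewrite subr_le0 ler_peMr// ler1n lt0n; move: i0; by rewrite -val_eqE.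
lra.
Qed.

End MomentFacts.

Section OffspringMoments.
Context {R : realType} {d0 : measure_display} {Om0 : measurableType d0}
  {P0 : probability Om0 R} (xi : {RV P0 >-> nat}).
Hypothesis mean_xi : ('E_P0[fun w => (xi w)%:R] = 1)%E.
Hypothesis var_xi : (0 < 'V_P0[fun w => (xi w)%:R] < +oo)%E.
Let p := offspring xi.

Lemma offspring_mass : (fun M => \sum_(i < M) p i) @ \oo --> (1 : R).
Proof.
apply: series_cvg; first exact: offspring_ge0.
have := expectation_series xi (g := fun=> 1) (fun=> ler01).
under eq_eseriesr do rewrite mulr1.
move=> <-; exact: expectation_cst.
Qed.

Lemma offspring_mean : (fun M => \sum_(i < M) p i * i%:R) @ \oo --> (1 : R).
Proof.
apply: (series_cvg (u := fun i => p i * i%:R)) => [i|].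
  by rewrite mulr_ge0// offspring_ge0.
by rewrite -(expectation_series xi (g := fun i => i%:R)).
Qed.

Lemma offspring_var : exists2 s2, 0 < s2 &
  (fun M => \sum_(i < M) p i * (i%:R - 1) ^+ 2) @ \oo --> (s2 : R).
Proof.
have E : ('V_P0[fun w => (xi w)%:R] = \sum_(0 <= i <oo) (p i * (i%:R - 1) ^+ 2)%:E)%E.
  rewrite -(expectation_series xi (g := fun i => (i%:R - 1) ^+ 2)) => [|i]; last exact: sqr_ge0.
  rewrite /variance unlock mean_xi /=; congr expectation; apply/funext => w.
move: var_xi; rewrite E; set S := (\sum_(0 <= i <oo) _)%E => /andP[S0 Soo].
have SE : S = (fine S)%:E by rewrite fineK// ge0_fin_numE// ltW.
exists (fine S); first by rewrite -lte_fin -SE.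
apply: (series_cvg (u := fun i => p i * (i%:R - 1) ^+ 2)) => [i|//].
by rewrite mulr_ge0 ?sqr_ge0// offspring_ge0.
Qed.

End OffspringMoments.

(** * Tails for the conditioned tree *)

Lemma half_complement (n m : nat) : (m.*2 <= n)%N -> (n <= 4 * (n - m))%N.
Proof. by lia. Qed.

Section ConditionedTails.
Context {R : realType} (p : nat -> R) (s2 : R) (p_ge0 : forall i, 0 <= p i).
Hypothesis s2_gt0 : 0 < s2.
Hypothesis mass : (fun M => \sum_(i < M) p i) @ \oo --> (1 : R).
Hypothesis mean : (fun M => \sum_(i < M) p i * i%:R) @ \oo --> (1 : R).
Hypothesis var : (fun M => \sum_(i < M) p i * (i%:R - 1) ^+ 2) @ \oo --> s2.

Let possible n := exists w,
  [/\ size w = n, sumn w = n.-1 & all (fun i => 0 < p i) w].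

Let mean_ge0 i : 0 <= p i * i%:R. Proof. by rewrite mulr_ge0. Qed.
Let fact2_ge0 i : 0 <= p i * (i%:R * i.-1%:R). Proof. by rewrite !mulr_ge0. Qed.
Let mass_le M : \sum_(i < M) p i <= 1. Proof. exact: partial_le. Qed.
Let mean_le M : \sum_(i < M) p i * i%:R <= 1.
Proof. exact: (partial_le (u := fun i => p i * i%:R)). Qed.
Let fact2_le M : \sum_(i < M) p i * (i%:R * i.-1%:R) <= s2.
Proof. exact: (partial_le (u := fun i => p i * (i%:R * i.-1%:R)) fact2_ge0 (factorial_moment mass mean var)). Qed.
Let mean_cvg e (e0 : 0 < e) : exists K, forall M, (K <= M)%N ->
  1 - e <= \sum_(i < M) p i * i%:R.
Proof. exact: (partial_ge (u := fun i => p i * i%:R)). Qed.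
Let fact2_cvg e (e0 : 0 < e) : exists K, forall M, (K <= M)%N ->
  s2 - e <= \sum_(i < M) p i * (i%:R * i.-1%:R).
Proof. exact: (partial_ge (u := fun i => p i * (i%:R * i.-1%:R)) fact2_ge0 (factorial_moment mass mean var)). Qed.
Let s21_gt0 : 0 < s2 + 1. Proof. by rewrite addr_gt0. Qed.
Let fact2_le' M : \sum_(i < M) p i * (i%:R * i.-1%:R) <= s2 + 1.
Proof. by apply: le_trans (fact2_le M) _; rewrite lerDl. Qed.
Let mass_ge M : (0 < M)%N -> 1 - (s2 + 1) / M%:R ^+ 2 <= \sum_(i < M) p i.
Proof. exact: mass_trunc. Qed.
Let mean_ge M : (0 < M)%N -> 1 - (s2 + 1) / M%:R <= \sum_(i < M) p i * i%:R.
Proof. exact: mean_trunc. Qed.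
Let p0_gt0 : 0 < p 0. Proof. exact: zero_letter s2_gt0 mass mean var. Qed.

Let total n : R := \sum_(t <- trees_of_size n) wtree p t.

(** In terms of trees, P(|T| = n) is at least of order n^(-3/2). *)
Lemma total_ge : exists2 c, 0 < c & exists N, forall n, (N <= n)%N -> possible n ->
  c <= n%:R * Num.sqrt n%:R * total n.
Proof.
have [B B2 pB] := large_letter p_ge0 s2_gt0 mass mean var.
have [c c0 [N hN]] := walk_lower p_ge0 s21_gt0 mass_le mean_le fact2_le'
  mass_ge mean_ge B2 p0_gt0 pB.
exists c => //; exists N.+1 => n Nn pn.
have n0 : (0 < n)%N by exact: leq_ltn_trans Nn.
have := hN n (ltnW Nn) pn; rewrite walk_cycle// ler_pdivrMr ?sqrtr_gt0 ?ltr0n//.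
by rewrite mulrAC.
Qed.

Lemma upper_tail rho : 1 / 2 < rho < 1 -> exists2 C, 0 < C & exists N, forall n k,
  (N <= n)%N -> possible n ->
  \sum_(t <- trees_of_size n | (k.+2 <= horton_strahler t)%N) wtree p t <=
    C * n%:R * (rho ^+ k) ^+ 2 * total n.
Proof.
move=> rho12; have [B B2 pB] := large_letter p_ge0 s2_gt0 mass mean var.
have [C C0 [K hK]] := horton_tail p_ge0 s2_gt0 mass_le mean_le fact2_le fact2_cvg B2 pB rho12.
have [C1 C10 hC1] := walk_upper p_ge0 s21_gt0 mass_le mass_ge B2 p0_gt0 pB.
have [c c0 [N hN]] := total_ge.
exists (s2 / 2 * C ^+ 2 * (2 * C1) / c).
  by rewrite divr_gt0// !mulr_gt0// exprn_gt0.
exists (maxn K (maxn B.+1 N)) => n k; rewrite !geq_max => /and3P[Kn BKn Nn] pn.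
have n0 : (0 < n)%N by exact: leq_ltn_trans BKn.
have nR : 0 < n%:R :> R by rewrite ltr0n.
have sn0 : 0 < Num.sqrt n%:R :> R by rewrite sqrtr_gt0.
have wt0 t := wtree_ge0 t p_ge0.
(* At most half of the nodes lie in u, so n - nb_nodes u is of order n. *)
pose A u := junction k u && ((nb_nodes u).*2 <= n)%N.
have := @fringe_union_bound _ p p_ge0 n A (fun t => (k.+2 <= horton_strahler t)%N) n0.
have hA t : nb_nodes t = n -> (k.+2 <= horton_strahler t)%N ->
    exists2 u, A u & infix (code u) (code t).
  move=> tn /small_junction[u ju [iu su]]; exists u => //.
  by rewrite /A ju -tn.
move=> /(_ hA); move/le_trans; apply.
apply: (@le_trans _ _ (\sum_(u <- trees n n | junction k u) wtree p u * (2 * C1 / Num.sqrt n%:R))).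
  rewrite big_mkcond [leRHS]big_mkcond; apply: ler_sum => u _.
  rewrite /A; case: (junction k u) => //=; case: ifP => [/andP[u2 un]|_]; last first.
    by rewrite mulr_ge0// divr_ge0 ?sqrtr_ge0// mulr_ge0// ltW.
  rewrite ler_wpM2l//.
  have hm := half_complement u2.
  have m0 : (0 < n - nb_nodes u <= n)%N.
    by rewrite leq_subr andbT; case: (n - nb_nodes u)%N hm => //; rewrite muln0 leqNgt n0.
  apply: le_trans (hC1 n _ _ BKn m0) _.
  have mR : 0 < (n - nb_nodes u)%:R :> R by rewrite ltr0n; case/andP: m0.
  rewrite ler_pdivrMr ?sqrtr_gt0// mulrAC ler_pdivlMr// (mulrC 2) -!mulrA ler_wpM2l ?(ltW C10)//.
  rewrite -(@ler_pXn2r _ 2) ?nnegrE ?mulr_ge0 ?sqrtr_ge0//.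
  rewrite exprMn !sqr_sqrtr ?(ltW mR) ?(ltW nR)//.
  have -> : 2 ^+ 2 = 4%:R :> R by ring.
  by rewrite -natrM ler_nat.
rewrite -big_distrl /=.
have hj := junction_le p_ge0 (mass_le n) (fun N => hK n k N Kn)
  (bin2_half_le fact2_le n) n.
apply: (@le_trans _ _ (s2 / 2 * (C * rho ^+ k) ^+ 2 * (2 * C1 / Num.sqrt n%:R))).
  by rewrite ler_wpM2r// divr_ge0 ?sqrtr_ge0// mulr_ge0// ltW.
have h1 : (Num.sqrt n%:R)^-1 <= n%:R * total n / c.
  rewrite ler_pdivlMr// mulrC ler_pdivrMr//; have := hN n Nn pn.
  by rewrite mulrAC.
set X := total n in h1 *; set Y := (Num.sqrt _)^-1 in h1 *.
have -> : s2 / 2 * (C * rho ^+ k) ^+ 2 * (2 * C1 * Y) =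
  s2 / 2 * C ^+ 2 * (2 * C1) * (rho ^+ k) ^+ 2 * Y by ring.
have -> : s2 / 2 * C ^+ 2 * (2 * C1) / c * n%:R * (rho ^+ k) ^+ 2 * X =
  s2 / 2 * C ^+ 2 * (2 * C1) * (rho ^+ k) ^+ 2 * (n%:R * X / c) by ring.
have rho0 : 0 <= rho by move/andP: rho12 => [h _]; lra.
by rewrite ler_wpM2l// !mulr_ge0 ?exprn_ge0 ?(ltW C10) ?(ltW C0) ?(ltW s2_gt0).
Qed.

Lemma lower_tail r : 0 < r < 1 / 2 -> exists c C, [/\ 0 < c, 0 < C & exists N,
  forall n k z, (N <= n)%N -> possible n -> 1 <= z -> z - 1 <= c * (r ^+ k) ^+ 2 ->
  z ^+ n * \sum_(t <- trees_of_size n | (horton_strahler t < k)%N) wtree p t <=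
    C * n%:R * Num.sqrt n%:R * total n].
Proof.
move=> r12; have [c c0 hc] := horton_small p_ge0 s2_gt0 mass_le fact2_le mean_cvg fact2_cvg r12.
have [c1 c10 [N hN]] := total_ge.
exists c, c1^-1; split=> //; first by rewrite invr_gt0.
exists N => n k z Nn pn z1 zc.
have z0 : 0 <= z by lra.
have wt0 t := wtree_ge0 t p_ge0.
apply: (@le_trans _ _ 1); last first.
  by rewrite -!mulrA mulrC ler_pdivlMr// mul1r; have := hN n Nn pn; rewrite -mulrA.
apply: le_trans (hc z n k n z1 zc).
rewrite big_distrr /= /trees_of_size big_filter_cond big_mkcond [leRHS]big_mkcond /=.
apply: ler_sum => t _; case: eqP => /= [tn|_].
  by case: ifP => // _; rewrite wtree_scale tn.
case: ifP => // _; rewrite wtree_scale mulr_ge0// exprn_ge0//.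
Qed.

End ConditionedTails.

(** * Exponents and conclusion *)

Section Exponents.
Context {R : realType}.
Implicit Types eps : R.

Let ln2 : R := ln 2.
Let ln2_gt0 : 0 < ln2. Proof. by rewrite ln_gt0// ltr1n. Qed.

Lemma ln_large (A : R) : exists N, forall n, (N <= n)%N ->
  [/\ (0 < n)%N, A <= ln n%:R & n%:R = expR (ln n%:R) :> R].
Proof.
have [N hN] := natr_large (expR A); exists N => n /hN An.
have n0 : 0 < n%:R :> R by apply: lt_le_trans An; exact: expR_gt0.
split; [by rewrite -(ltr0n R)| |by rewrite lnK].
by rewrite -(expRK A) ler_ln ?posrE ?expR_gt0.
Qed.

Lemma expR_small (a e : R) : 0 < a -> 0 < e -> forall L, - ln e / a <= L -> expR (- (a * L)) <= e.
Proof.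
move=> a0 e0 L; rewrite ler_pdivrMr// => h.
by rewrite -[leRHS]lnK ?posrE// ler_expR; lra.
Qed.

Lemma nat_part (x : R) : 0 <= x -> exists m : nat, m%:R <= x < m.+1%:R.
Proof. by move=> x0; exists (Num.truncn x); exact: truncn_itv. Qed.

(** With rho = 2^(-1/(1+eps)) and k close to (1/2 + eps) log2 n, the product
    n rho^(2k) is of order n^(-eps/(1+eps)). *)
Lemma upper_exponent eps : 0 < eps -> exists2 rho : R, 1 / 2 < rho < 1 &
  forall C e, 0 < C -> 0 < e -> exists N, forall n, (N <= n)%N -> exists k,
    (forall h : nat, 1 / 2 + eps < h%:R / log2 n%:R -> (k.+2 <= h)%N) /\
    C * n%:R * (rho ^+ k) ^+ 2 <= e.
Proof.
move=> eps0; pose q := ln2 / (1 + eps).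
have e1 : 0 < 1 + eps by lra.
have q0 : 0 < q by rewrite divr_gt0.
exists (expR (- q)).
  rewrite expR_lt1 oppr_lt0 q0 andbT.
  have -> : 1 / 2 = expR (- ln2) :> R by rewrite expRN lnK ?posrE// mul1r.
  by rewrite ltr_expR ltrN2 ltr_pdivrMr// ltr_pMr//; lra.
move=> C e C0 e0; pose a := eps / (1 + eps).
have a0 : 0 < a by rewrite divr_gt0.
pose e' := e / (C * expR (6 * q)).
have e'0 : 0 < e' by rewrite divr_gt0 ?mulr_gt0 ?expR_gt0.
have [N hN] := ln_large (`|- ln e' / a| + 4 * ln2).
exists N => n /hN[n0 nL nE]; set L := ln n%:R in nL nE.
have z0 : 0 <= `|- ln e' / a| by [].
have L2 : 4 * ln2 <= L by lra.
have L0 : 0 < L by have := ln2_gt0; lra.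
have La : - ln e' / a <= L by have := ler_norm (- ln e' / a); have := ln2_gt0; lra.
pose x := (1 / 2 + eps) * L / ln2.
have x2 : 2 <= x by rewrite ler_pdivlMr//; have := mulr_gt0 eps0 L0; lra.
have [|m /andP[mx xm]] := @nat_part x; first lra.
have m2 : (2 <= m)%N by rewrite -ltnS -(ltr_nat R); lra.
exists (m - 2)%N; split=> [h|].
  rewrite /log2 -/ln2 -/L ltr_pdivlMr ?divr_gt0// mulrA -/x => xh.
  by rewrite -addn2 subnK// -ltnS ltnW// ltnS -(ltr_nat R); lra.
have kE : (m - 2)%:R = m%:R - 2 :> R by rewrite natrB.
have xq : x * q = (1 / 2 + eps) * L / (1 + eps).
  by rewrite /x /q; field; rewrite !gt_eqF.
rewrite -!expRM_natl nE -mulrA -expRD.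
apply: (@le_trans _ _ (C * expR (6 * q + (- (a * L))))).
  rewrite ler_wpM2l ?(ltW C0)// ler_expR kE.
  have h : (x - 3) * q <= (m%:R - 2) * q.
    by rewrite ler_wpM2r ?(ltW q0)//; move: xm; rewrite -natr1; lra.
  have h2 : L - 2 * (x * q) = - (a * L) by rewrite xq /a; field; rewrite gt_eqF.
  lra.
rewrite expRD mulrA mulrC -ler_pdivlMr ?mulr_gt0 ?expR_gt0//.
exact: expR_small.
Qed.

(** With r = 2^-(1+eps) and k close to (1/2 - eps) log2 n, r^(2k) is at least of
    order n^(eps-1), so that z = 1 + d n^(eps-1) is allowed, and z^n beats every
    power of n. *)
Lemma lower_exponent eps : 0 < eps <= 1 / 4 -> exists2 r : R, 0 < r < 1 / 2 &
  forall C c e, 0 < C -> 0 < c -> 0 < e -> exists N, forall n, (N <= n)%N ->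
  exists k z, [/\ forall h : nat, h%:R / log2 n%:R < 1 / 2 - eps -> (h < k)%N,
    1 <= z, z - 1 <= c * (r ^+ k) ^+ 2 & C * n%:R * Num.sqrt n%:R <= e * z ^+ n].
Proof.
move=> /andP[eps0 eps4]; pose q := (1 + eps) * ln2.
have q0 : 0 < q by rewrite mulr_gt0//; lra.
exists (expR (- q)).
  rewrite expR_gt0/=.
  have -> : 1 / 2 = expR (- ln2) :> R by rewrite expRN lnK ?posrE// mul1r.
  by rewrite ltr_expR ltrN2 ltr_pMl//; lra.
move=> C c e C0 c0 e0; pose d := Num.min 1 c * expR (- (2 * q)).
have m0 : 0 < Num.min 1 c by rewrite lt_min ltr01.
have d0 : 0 < d by rewrite mulr_gt0 ?expR_gt0.
have d1 : d <= 1.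
  rewrite /d -[leRHS]mulr1 ler_pM ?(ltW m0) ?expR_ge0// ?ge_min ?lexx//.
  by rewrite expR_le1 oppr_le0 mulr_ge0// ltW.
have [N hN] := ln_large (24 / (d * eps ^+ 2) + `|ln (C / e)|).
exists N => n /hN[n0 nL nE]; set L := ln n%:R in nL nE.
have t0 : 0 < 24 / (d * eps ^+ 2) by rewrite divr_gt0// mulr_gt0// exprn_gt0.
have t1 : 0 <= `|ln (C / e)| by [].
have L0 : 0 < L by lra.
have dd : 0 < d * eps ^+ 2 by rewrite mulr_gt0 ?exprn_gt0.
have Ld : 24 <= d * eps ^+ 2 * L.
  by rewrite [leRHS]mulrC -ler_pdivrMr//; apply: le_trans nL; rewrite lerDl.
have Le : ln (C / e) <= L by have := ler_norm (ln (C / e)); lra.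
pose x := (1 / 2 - eps) * L / ln2.
have x0 : 0 <= x by rewrite divr_ge0 ?(ltW ln2_gt0)// mulr_ge0 ?(ltW L0)//; lra.
have [m /andP[mx xm]] := nat_part x0.
pose eta := d * expR (- ((1 - eps) * L)).
have eta0 : 0 < eta by rewrite mulr_gt0 ?expR_gt0.
have eta1 : eta <= 1.
  rewrite /eta -[leRHS]mulr1 ler_pM ?(ltW d0) ?expR_ge0//.
  by rewrite expR_le1 oppr_le0 mulr_ge0 ?(ltW L0)//; lra.
exists m.+1, (1 + eta); split.
- move=> h; rewrite /log2 -/ln2 -/L ltr_pdivrMr ?divr_gt0// mulrA -/x => hx.
  by rewrite -(ltr_nat R); lra.
- lra.
- rewrite addrC addKr -!expRM_natl.
  apply: (@le_trans _ _ (Num.min 1 c * (expR (- (2 * q)) * expR (- ((1 - eps) * L))))).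
    by rewrite /eta /d [leRHS]mulrA lexx.
  rewrite ler_pM ?(ltW m0) ?mulr_ge0 ?expR_ge0 ?ge_min ?lexx ?orbT//.
  rewrite -expRD ler_expR.
  have xq : x * q = (1 / 2 - eps) * (1 + eps) * L.
    by rewrite /x /q; field; rewrite gt_eqF.
  have h : m.+1%:R * q <= (x + 1) * q.
    by rewrite ler_wpM2r ?(ltW q0)// -natr1; lra.
  have h2 : 0 <= eps ^+ 2 * L by rewrite mulr_ge0 ?sqr_ge0 ?(ltW L0).
  have h3 : 2 * (x * q) = (1 - eps) * L - 2 * (eps ^+ 2 * L) by rewrite xq; field.
  lra.
have zexp : expR (eta / 2) <= 1 + eta.
  rewrite -[eta / 2]opprK expRN -[leRHS]invrK lef_pV2 ?posrE ?expR_gt0 ?invr_gt0//; last lra.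
  apply: le_trans (expR_ge1Dx _).
  rewrite -[leLHS]mul1r ler_pdivrMr; last lra.
  have : 0 <= eta * (1 - eta) by rewrite mulr_ge0//; lra.
  lra.
have eta2 : 3 * L <= n%:R * (eta / 2).
  have -> : n%:R * (eta / 2) = d / 2 * expR (eps * L).
    rewrite nE /eta -/L.
    have -> : expR (eps * L) = expR L * expR (- ((1 - eps) * L)).
      by rewrite -expRD; congr expR; ring.
    by field.
  have h1 : (1 + eps * L / 2) ^+ 2 <= expR (eps * L).
    have -> : eps * L = 2%:R * (eps * L / 2) by field.
    rewrite expRM_natl.
    have y0 : 0 <= eps * L / 2 by rewrite divr_ge0// mulr_ge0// ltW.
    rewrite (_ : 2%:R * (eps * L / 2) / 2 = eps * L / 2); last by field.
    by rewrite lerXn2r ?nnegrE ?expR_ge0 ?expR_ge1Dx ?addr_ge0.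
  have h2 : (eps * L) ^+ 2 / 4 <= expR (eps * L).
    have := mulr_gt0 eps0 L0; lra.
  have h3 : d / 2 * ((eps * L) ^+ 2 / 4) <= d / 2 * expR (eps * L).
    by rewrite ler_wpM2l// divr_ge0// ltW.
  apply: le_trans h3.
  have -> : d / 2 * ((eps * L) ^+ 2 / 4) = d * eps ^+ 2 * L / 8 * L by field.
  rewrite ler_wpM2r ?(ltW L0)//; lra.
have zn : expR (3 * L) <= (1 + eta) ^+ n.
  apply: (@le_trans _ _ (expR (eta / 2) ^+ n)).
    by rewrite -expRM_natl ler_expR.
  by rewrite lerXn2r ?nnegrE ?expR_ge0//; lra.
apply: (@le_trans _ _ (e * expR (3 * L))); last by rewrite ler_wpM2l// ltW.
have n1 : 1 <= n%:R :> R by rewrite ler1n.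
apply: (@le_trans _ _ (C * n%:R * n%:R)).
  rewrite ler_wpM2l ?mulr_ge0 ?(ltW C0)//.
  rewrite -(@ler_pXn2r _ 2) ?nnegrE ?sqrtr_ge0// sqr_sqrtr// expr2 ler_peMr//.
rewrite nE -/L (_ : 3 * L = L + (L + L)); last by ring.
rewrite !expRD -mulrA [leRHS]mulrA ler_wpM2r ?mulr_ge0 ?expR_ge0//.
by rewrite mulrC -ler_pdivrMr// -[leLHS]lnK ?posrE ?divr_gt0// ler_expR.
Qed.

End Exponents.

Theorem mainTheorem1 (R : realType)
  (d0 : measure_display) (Om0 : measurableType d0) (P0 : probability Om0 R)
  (xi : {RV P0 >-> nat})
  (mean_xi : ('E_P0[fun w => (xi w)%:R] = 1)%E)
  (var_xi : (0 < 'V_P0[fun w => (xi w)%:R] < +oo)%E)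
  (d : measure_display) (Om : measurableType d) (P : probability Om R)
  (X : seq nat -> {RV P >-> nat}) (gwX : galton_watson xi X)
  (d' : nat -> measure_display) (Om' : forall n, measurableType (d' n))
  (P' : forall n, probability (Om' n) R) (T : forall n, {RV P' n >-> tree})
  (condT : forall n, admissible X n -> conditioned_gw X n (T n)) :
  cvg_in_probability (within (admissible X) \oo) P'
    (fun n w => (horton_strahler (T n w))%:R / log2 n%:R) (1 / 2).
Proof.
have p0 := offspring_ge0 xi; set p := offspring xi in p0.
have mass : (fun M => \sum_(i < M) p i) @ \oo --> (1 : R) := offspring_mass xi.
have mean : (fun M => \sum_(i < M) p i * i%:R) @ \oo --> (1 : R) := offspring_mean mean_xi.
have [s2 s20 var] := offspring_var mean_xi var_xi.
move=> eps eps0; pose ep := Num.min eps (1 / 4).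
have ep0 : 0 < ep by rewrite lt_min eps0; lra.
have ep4 : 0 < ep <= 1 / 4 by rewrite ep0 /= ge_min lexx orbT.
have [rho rho12 hrho] := upper_exponent ep0.
have [r r12 hr] := lower_exponent ep4.
have [C C0 [N1 hU]] := upper_tail p0 s20 mass mean var rho12.
have [c [C' [c0 C'0 [N2 hL]]]] := lower_tail p0 s20 mass mean var r12.
pose A n : set tree := [set t | eps < `|(horton_strahler t)%:R / log2 n%:R - 1 / 2|].
have mA n : measurable (T n @^-1` A n) by exact: measurable_funPTI.
suff H (e : R) : 0 < e -> exists N, forall n, (N <= n)%N -> admissible X n ->
    (P' n (T n @^-1` A n) <= e%:E)%E.
  apply/fine_cvgP; split.
    rewrite near_withinE; near=> n => _ /=; exact: fin_num_measure (mA n).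
  apply/cvgrPdist_le => e e0; rewrite near_withinE.
  have [N hN] := H e e0; exists N => // n /= Nn an.
  rewrite sub0r normrN ger0_norm ?fine_ge0//.
  by rewrite -lee_fin fineK; [exact: hN|exact: fin_num_measure (mA n)].
move=> e0; have e20 : 0 < e / 2 by rewrite divr_gt0.
have [N3 hN3] := hrho C (e / 2) C0 e20.
have [N4 hN4] := hr C' c (e / 2) C'0 c0 e20.
exists (maxn (maxn N1 N2) (maxn N3 N4)) => n.
rewrite !geq_max => /andP[/andP[n1 n2] /andP[n3 n4]] an.
have pn := admissible_word gwX an.
rewrite (conditioned_prob gwX (A n) (condT n an)) lee_fin.
rewrite -/p; set S := \sum_(t <- trees_of_size n) wtree p t.
have S0 : 0 < S by move: an; rewrite /admissible /= (P_gw_size gwX) lte_fin.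
rewrite ler_pdivrMr//.
have [k [hk ke]] := hN3 n n3.
have [j [z [hj z1 zc ze]]] := hN4 n n4.
have wt0 t := wtree_ge0 t p0.
apply: (@le_trans _ _ (\sum_(t <- trees_of_size n | (k.+2 <= horton_strahler t)%N) wtree p t +
  \sum_(t <- trees_of_size n | (horton_strahler t < j)%N) wtree p t)).
  rewrite [leLHS]big_mkcond [X in _ <= X + _]big_mkcond [X in _ <= _ + X]big_mkcond -big_split /=.
  apply: ler_sum => t _; case: ifP => [/asboolP At|_]; last first.
    by rewrite addr_ge0//; case: ifP.
  have : ep < `|(horton_strahler t)%:R / log2 n%:R - 1 / 2| :> R.
    by apply: le_lt_trans At; rewrite ge_min lexx.
  rewrite lter_normr => /orP[h|h].
    rewrite (hk (horton_strahler t)); last lra.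
    by rewrite lerDl; case: ifP.
  rewrite [X in _ + (if X then _ else _)](hj (horton_strahler t)); last lra.
  by rewrite lerDr; case: ifP.
have u1 := hU n k n1 pn.
have u2 := hL n j z n2 pn z1 zc.
rewrite -/S in u1 u2; set SU := \sum_(t <- _ | (k.+1 < _)%N) _ in u1 *.
set SL := \sum_(t <- _ | _) _ in u2 *.
have u3 : SU <= e / 2 * S by apply: le_trans u1 _; rewrite ler_wpM2r// ltW.
have zn0 : 0 < z ^+ n by rewrite exprn_gt0//; lra.
have u4 : SL <= e / 2 * S.
  rewrite -(ler_pM2l zn0); apply: le_trans u2 _.
  by rewrite mulrCA mulrA ler_wpM2r ?(ltW S0)// (mulrC _ (z ^+ n)) mulrC.
lra.
Unshelve. all: by end_near.
Qed.
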